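(* Fix $n\in\{0,\dots,N-1\}$. Assume that there are constants $\lambda_1,\lambda_2>0$ such that for all $x,y\in\mathbb{R}^d$ and every grid time $t\in\{t_0,\dots,t_{N-1}\}$ $$|\rho(x,t;y,t+\Delta t)|\le \frac{1}{\lambda_1}\exp(-\lambda_1\|x-y\|),\qquad |\nabla_x\rho(x,t;y,t+\Delta t)|\le \frac{1}{\lambda_2}\exp(-\lambda_2\|x-y\|),$$ and that $|\widehat V_i(t_{n+1},x)|\le L(\|x\|+1)$ for all $x\in\mathbb{R}^d$, all $i=1,\dots,D$ and some $L>0$. Then for any fixed bounded set $Q\subset\mathbb{R}^d$ there exist positive constants $C_0$ (used as the truncation constant in the definition of $\widehat g_j(t_n,\cdot)$), $C_1$, $C_2$ and $\sigma$, depending only on $d,L,Q,\lambda_1,\lambda_2$, such that for any $\delta>0$ and every $i\in\{1,\dots,D\}$ $$\mathbb{P}\Big(\sup_{x\in Q}|\widehat V_i(t_n,x)-\widetilde V_i(t_n,x)|\ge\delta\Big)\le 2D\binom{M}{k}\max\left\{\exp\Big(-\frac{k m_Y\delta^2}{18\sigma^2}\Big),\exp\Big(-\frac{k m_Y\delta}{6\sigma}\Big)\right\}+D\cdot B(\delta),$$ where $$B(\delta)=\begin{cases} C_1\dfrac{|Q|}{\delta^{d}}\exp\left(-\dfrac{M\left(\frac{M-k}{M}-\sup_{x\in Q}p^c_{\delta/(4C_2)}(x)\right)_+^2}{2}\right) & \text{if }\delta/C_2\le 1,\\[3mm] C_1\dfrac{|Q|}{\delta^{d/2}}\exp\left(-\dfrac{M\left(\frac{M-k}{M}-\sup_{x\in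 Q}p^c_{\sqrt{\delta/(4C_2)}}(x)\right)_+^2}{2}\right) & \text{if }\delta/C_2>1.\end{cases}$$ Here $p^c_r(x)=\mathbb{P}(X_{t_n}\notin B(x,r))$, $B(x,r)$ is the Euclidean ball of radius $r$ centered at $x$, and $|Q|$ is the volume of $Q$.
   Context: Setting. Let $d,D,M,N,m_Y,k$ be positive integers with $k\le M$, $T>0$, $\Delta t=T/N$, $t_n=n\Delta t$. $(X_{t_n})_{n=0}^N$ is a (time-discretized) Markov process in $\mathbb{R}^d$ whose starting point is drawn from a sub-Gaussian distribution $\mu_0$ and whose one-step transition kernel from $t_n$ to $t_{n+1}$ has a density $y\mapsto\rho(x,t_n;y,t_n+\Delta t)$. There are $D$ modes with payoff functions $f_j(t,x)$ and switching costs $c_{ij}(t,x)$ satisfying $c_{ii}=0$, $c_{ij}>0$ for $i\ne j$, and $c_{ij}+c_{jl}\ge c_{il}$ for pairwise distinct $i,j,l$. $\|\cdot\|$ is the Euclidean norm and $(a)_+=\max\{a,0\}$. Data. $\mathcal{X}=\{X^s_{t_0},\dots,X^s_{t_N};\ s=1,\dots,M\}$ consists of $M$ independent copies of the trajectory. For each $n<N$ and $s$, $\widetilde X^{s,\hat s}_{t_{n+1}}$, $\hat s=1,\dots,m_Y$, are simulated one-step transitions started from $X^s_{t_n}$: conditional on $\mathcal{X}$, all of these are mutually independent across $(n,s,\hat s)$, and $\widetilde X^{s,\hat s}_{t_{n+1}}$ has density $\rho(X^s_{t_n},t_n;\cdot,t_{n+1})$. $\mathcal{N}_{t_n}(x)$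 is the set of indices $s$ of the $k$ points among $X^1_{t_n},\dots,X^M_{t_n}$ nearest to $x$. Estimators (backward recursion). Start from $\widehat V_j(t_N,x)=0$. For $n=N-1,\dots,0$, given $\widehat V_j(t_{n+1},\cdot)$, $j=1,\dots,D$, define $$g_j(t_n,x)=\int_{\mathbb{R}^d}\widehat V_j(t_{n+1},y)\rho(x,t_n;y,t_n+\Delta t)\,dy,\qquad \widetilde g_j(t_n,x)=\frac{1}{k m_Y}\sum_{s\in\mathcal{N}_{t_n}(x)}\sum_{\hat s=1}^{m_Y}\widehat V_j(t_{n+1},\widetilde X^{s,\hat s}_{t_{n+1}}),$$ the truncation $$\widehat g_j(t_n,x)=\mathrm{sign}(\widetilde g_j(t_n,x))\min\{|\widetilde g_j(t_n,x)|,\,2C_0(\|x\|+1)\}$$ with a given constant $C_0$ (which may depend on $n$), and $$\widetilde V_i(t_n,x)=\max_{j=1,\dots,D}[\Delta t f_j(t_n,x)-c_{ij}(t_n,x)+g_j(t_n,x)],\qquad \widehat V_i(t_n,x)=\max_{j=1,\dots,D}[\Delta t f_j(t_n,x)-c_{ij}(t_n,x)+\widehat g_j(t_n,x)].$$ Note that $g_j$ and $\widetilde V_i$ are random, through $\widehat V_j(t_{n+1},\cdot)$.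
   Formalization: The bounded set Q is assumed to have positive volume |Q| > 0; for a nonempty Q of volume zero, B(δ) vanishes and the stated bound fails because the nearest-neighbour bias does not disappear as m_Y grows. *)

(* Defs.v *)
From HB Require Import structures.
From mathcomp Require Import all_boot all_order all_algebra.
From mathcomp Require Import all_classical all_reals all_analysis.

Set Implicit Arguments.
Unset Strict Implicit.
Unset Printing Implicit Defensive.

Import Order.TTheory GRing.Theory Num.Theory.
Import numFieldNormedType.Exports.

Local Open Scope classical_set_scope.
Local Open Scope ring_scope.

Fact rV_display : measure_display.
Proof. exact: default_measure_display. Qed.

Section rV_measurable.
Context (R : realType) (d : nat).

Definition rV_coord (i : 'I_d) (v : 'rV[R]_d) : R := v 0 i.

(* The library has no sigma-algebra on row vectors: this is the product of the
   Borel sigma-algebras of the coordinates, i.e. the Borel sets of R^d. *)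
HB.instance Definition _ := @isMeasurable.Build rV_display 'rV[R]_d
  (g_sigma_preimage rV_coord)
  (@sigma_algebra0 _ setT _) (@sigma_algebraC _ _) (@sigma_algebra_bigcup _ setT _).

End rV_measurable.

Section rV_lebesgue.
Context (R : realType).

Lemma measurable_rV_coord d (i : 'I_d) :
  measurable_fun [set: 'rV[R]_d] (@rV_coord R d i).
Proof.
move=> _ Y mY; apply: sub_sigma_algebra => /=.
by rewrite -bigcup_seq/=; exists i => /=; [rewrite mem_index_enum|exists Y].
Qed.

Lemma measurable_fun_rV d0 (T : measurableType d0) d (f : T -> 'rV[R]_d) :
  (forall i, measurable_fun [set: T] (fun x => f x 0 i)) ->
  measurable_fun [set: T] f.
Proof.
move=> mf.
apply: (@measurability _ _ _ _ setT f
  (\big[setU/set0]_(i < d) preimage_set_system setT (@rV_coord R d i) measurable)) => //.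
move=> _ [B + <-]; rewrite -bigcup_seq => -[i _ [A mA <-]].
by rewrite setTI -comp_preimage -[X in measurable X]setTI setTI; apply: mf.
Qed.

Definition rV_cons d (p : R * 'rV[R]_d) : 'rV[R]_d.+1 :=
  \row_i oapp (p.2 0) p.1 (unlift ord0 i).

Definition rV_uncons d (v : 'rV[R]_d.+1) : R * 'rV[R]_d :=
  (v 0 ord0, \row_i v 0 (lift ord0 i)).

Lemma rV_consK d : cancel (@rV_cons d) (@rV_uncons d).
Proof.
move=> [a v]; rewrite /rV_uncons mxE unlift_none; congr pair.
by apply/rowP => i; rewrite !mxE liftK.
Qed.

Lemma rV_unconsK d : cancel (@rV_uncons d) (@rV_cons d).
Proof.
move=> v; apply/rowP => i; rewrite mxE.
by have [j ->|->] := unliftP ord0 i; rewrite ?liftK ?unlift_none //= mxE.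
Qed.

Lemma measurable_rV_cons d : measurable_fun setT (@rV_cons d).
Proof.
apply: measurable_fun_rV => i; under eq_fun do rewrite mxE.
case: unliftP => [j _|_] //=.
  exact: measurableT_comp (measurable_rV_coord j) measurable_snd.
exact: measurable_fst.
Qed.

Lemma measurable_rV_uncons d : measurable_fun setT (@rV_uncons d).
Proof.
apply: measurable_fun_pair; first exact: measurable_rV_coord.
apply: measurable_fun_rV => i; under eq_fun do rewrite mxE.
exact: measurable_rV_coord.
Qed.

Section rV_product.
Context d (m : {sigma_finite_measure set 'rV[R]_d -> \bar R}).

Definition rV_product : set 'rV[R]_d.+1 -> \bar R :=
  pushforward (@lebesgue_measure R \x m)%E (@rV_cons d).

Let rV_product0 : rV_product set0 = 0%E.
Proof. by rewrite /rV_product /pushforward preimage_set0 measure0. Qed.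

Let rV_product_ge0 A : (0 <= rV_product A)%E.
Proof. by rewrite /rV_product /pushforward measure_ge0. Qed.

Let rV_product_sigma_additive : semi_sigma_additive rV_product.
Proof.
have mK A : measurable A -> measurable (@rV_cons d @^-1` A).
  by move=> mA; rewrite -[X in measurable X]setTI; exact: measurable_rV_cons.
move=> F mF tF mUF; rewrite /rV_product /pushforward preimage_bigcup.
apply: measure_semi_sigma_additive; first by move=> n; exact: mK.
- apply/trivIsetP => i j _ _ ij; rewrite -preimage_setI.
  by move/trivIsetP : tF => /(_ _ _ _ _ ij) ->//; rewrite preimage_set0.
- by rewrite -preimage_bigcup; exact: mK.
Qed.

HB.instance Definition _ := isMeasure.Build _ _ _ rV_product
  rV_product0 rV_product_ge0 rV_product_sigma_additive.

Let rV_product_sigma_finite : sigma_finite setT rV_product.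
Proof.
have /sigma_finiteP[F [FT ndF Foo]] := sigma_finiteT (@lebesgue_measure R).
have /sigma_finiteP[G [GT ndG Goo]] := sigma_finiteT m.
exists (fun n => @rV_uncons d @^-1` (F n `*` G n)).
  apply/esym; rewrite -subTset => v _.
  have [i _ Fi] : (\bigcup_i F i) (rV_uncons v).1 by rewrite -FT.
  have [j _ Gj] : (\bigcup_i G i) (rV_uncons v).2 by rewrite -GT.
  exists (maxn i j) => //; split.
  - by move: Fi; exact/subsetPset/ndF/leq_maxl.
  - by move: Gj; exact/subsetPset/ndG/leq_maxr.
move=> n; have [mF Fn] := Foo n; have [mG Gn] := Goo n; split.
  rewrite -[X in measurable X]setTI; apply: measurable_rV_uncons => //.
  exact: measurableX.
rewrite /rV_product /pushforward -comp_preimage.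
rewrite (_ : _ \o _ = id); last by apply/funext => p /=; rewrite rV_consK.
by rewrite preimage_id product_measure1E// lte_mul_pinfty// ge0_fin_numE.
Qed.

HB.instance Definition _ :=
  Measure_isSigmaFinite.Build _ _ _ rV_product rV_product_sigma_finite.

End rV_product.

Fixpoint rV_lebesgue d : {sigma_finite_measure set 'rV[R]_d -> \bar R} :=
  match d with
  | 0 => \d_ (0 : 'rV[R]_0)
  | d'.+1 => rV_product (rV_lebesgue d')
  end.

End rV_lebesgue.

Lemma rV_lebesgue_box (R : realType) d (a b : 'rV[R]_d) :
  (forall i, a 0 i <= b 0 i) ->
  rV_lebesgue R d [set v | forall i, a 0 i <= v 0 i <= b 0 i] =
  (\prod_(i < d) (b 0 i - a 0 i))%:E.
Proof.
elim: d => [|d IH] in a b *.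
  move=> _; rewrite big_ord0 /= diracE mem_set// => i; by case: i.
move=> ab; rewrite big_ord_recl /= /rV_product /pushforward.
pose a' : 'rV[R]_d := \row_i a 0 (lift ord0 i).
pose b' : 'rV[R]_d := \row_i b 0 (lift ord0 i).
pose box := [set v : 'rV[R]_d | forall i, a' 0 i <= v 0 i <= b' 0 i].
have mbox : measurable box.
  rewrite (_ : box = \big[setI/setT]_(i < d)
      (@rV_coord R d i @^-1` `[a' 0 i, b' 0 i]%classic)); last first.
    rewrite -bigcap_seq; apply/seteqP; split => v /= H i.
      by move=> _; rewrite /= in_itv/=; exact: H.
    by have /= := H i; rewrite in_itv/=; apply; rewrite mem_index_enum.
  apply: bigsetI_measurable => i _.
  by rewrite -[X in measurable X]setTI; exact: measurable_rV_coord.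
rewrite (_ : _ @^-1` _ = `[a 0 ord0, b 0 ord0]%classic `*` box); last first.
  apply/seteqP; split => -[x v] /=.
    move=> H; split; first by have := H ord0; rewrite mxE unlift_none in_itv.
    by move=> i; have := H (lift ord0 i); rewrite !mxE liftK.
  move=> [+ H] i; rewrite in_itv/= => xab; rewrite mxE.
  have [j ->|->] := unliftP ord0 i; rewrite ?liftK ?unlift_none//=.
  by have := H j; rewrite !mxE.
rewrite product_measure1E//= IH; last by move=> i; rewrite !mxE.
rewrite lebesgue_measure_itv/= lte_fin.
under eq_bigr do rewrite !mxE.
rewrite EFinM; congr (_ * _)%E.
by case: ltP => // ba; rewrite (_ : b 0 ord0 = a 0 ord0) ?subrr//; apply/le_anti; rewrite ba ab.
Qed.

Section euclidean.
Context (R : realType) (d : nat).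
Implicit Types (x y v : 'rV[R]_d) (r : R).

(* The library norm on row vectors is the max norm, hence the explicit
   Euclidean one. *)
Definition enorm v : R := Num.sqrt (\sum_i v 0 i ^+ 2).

Definition dotp v x : R := \sum_i v 0 i * x 0 i.

Definition eball x r : set 'rV[R]_d := [set y | enorm (y - x) < r].

Definition gradient (h : 'rV[R]_d -> R) x : 'rV[R]_d :=
  \row_i 'D_(delta_mx 0 i) h x.

(* Outer Lebesgue measure, so that |Q| makes sense for every Q; it agrees with
   rV_lebesgue on measurable sets. *)
Definition volume (Q : set 'rV[R]_d) : \bar R := mu_ext (rV_lebesgue R d) Q.

End euclidean.

Section laws.
Context (R : realType) (d : nat).
Local Notation E := 'rV[R]_d.
Local Notation leb := (rV_lebesgue R d).

Definition sub_gaussian (mu : probability E R) : Prop :=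
  exists2 K : R, 0 < K & forall v : E, enorm v = 1 -> forall r : R, 0 <= r ->
    (mu [set x | (r <= `|dotp v x|)%R] <= (2 * expR (- (r / K) ^+ 2))%:E)%E.

Definition transition_density (p : E -> E -> R) : Prop :=
  [/\ measurable_fun [set: E * E] (fun z => p z.1 z.2),
      forall x y, 0 <= p x y &
      forall x, (\int[leb]_y (p x y)%:E = 1)%E].

Definition transition_prob (p : E -> E -> R) (x : E) (B : set E) : R :=
  \int[leb]_(y in B) p x y.

Variable N : nat.

(* A trajectory is the tuple of its N.+1 positions; x`_n is the position at
   the n-th grid time. *)
Definition past (n : nat) (x : N.+1.-tuple E) : n.+1.-tuple E :=
  [tuple x`_i | i < n.+1].

(* X starts from mu0 and P(X_{n+1} \in B | X_0, ..., X_n) is the integral over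
   B of p n (X_n). *)
Definition markov_chain (mu0 : probability E R) (p : nat -> E -> E -> R)
    disp (Omega : measurableType disp) (P : probability Omega R)
    (X : {RV P >-> N.+1.-tuple E}) : Prop :=
  (forall B : set E, measurable B -> P [set w | B (X w)`_0] = mu0 B) /\
  (forall n, (n < N)%N ->
   forall (A : set (n.+1.-tuple E)) (B : set E), measurable A -> measurable B ->
     P [set w | A (past n (X w)) /\ B (X w)`_n.+1] =
     \int[P]_(w in [set w | A (past n (X w))])
       (transition_prob (p n) (X w)`_n B)%:E)%E.

Definition independent_copies (M : nat)
    disp0 (Omega0 : measurableType disp0) (P0 : probability Omega0 R)
    (X : {RV P0 >-> N.+1.-tuple E})
    disp (Omega : measurableType disp) (P : probability Omega R)
    (Xs : 'I_M -> {RV P >-> N.+1.-tuple E}) : Prop :=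
  (forall s (A : set (N.+1.-tuple E)), measurable A ->
     distribution P (Xs s) A = distribution P0 X A) /\
  (forall A : 'I_M -> set (N.+1.-tuple E), (forall s, measurable (A s)) ->
     P [set w | forall s, A s (Xs s w)] =
     (\prod_(s < M) fine (P (Xs s @^-1` A s)))%:E).

(* Conditionally on the data set (Xs s w)_s, the Y n s h with n < N are
   independent and Y n s h has density p n (Xs s)_n; Y n s h is the h-th
   simulated position at time n.+1 started from (Xs s)_n at time n. *)
Definition conditional_simulations (M m : nat) (p : nat -> E -> E -> R)
    disp (Omega : measurableType disp) (P : probability Omega R)
    (Xs : 'I_M -> {RV P >-> N.+1.-tuple E})
    (Y : nat -> 'I_M -> 'I_m -> {RV P >-> E}) : Prop :=
  forall (A : set (M.-tuple (N.+1.-tuple E))) (B : 'I_N -> 'I_M -> 'I_m -> set E),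
    measurable A -> (forall n s h, measurable (B n s h)) ->
    (P [set w | A [tuple Xs s w | s < M] /\
                forall (n : 'I_N) s h, B n s h (Y n s h w)] =
     \int[P]_(w in [set w | A [tuple Xs s w | s < M]])
       (\prod_(n < N) \prod_(s < M) \prod_(h < m)
          transition_prob (p n) (Xs s w)`_n (B n s h))%:E)%E.

End laws.

(* A k-nearest-neighbour rule: distance ties may be broken in any Borel way. *)
Record knn_rule (R : realType) (d M k : nat) := KnnRule {
  knn_select :> M.-tuple 'rV[R]_d -> 'rV[R]_d -> {set 'I_M};
  knn_card : forall pts x, #|knn_select pts x| = k;
  knn_nearest : forall pts x s s',
    s \in knn_select pts x -> s' \notin knn_select pts x ->
    enorm (tnth pts s - x) <= enorm (tnth pts s' - x);
  knn_measurable : forall I : {set 'I_M},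
    measurable [set z : M.-tuple 'rV[R]_d * 'rV[R]_d | knn_select z.1 z.2 = I]
}.

Definition time_step (R : realType) (T : R) (N : nat) : R := T / N%:R.

Definition grid_time (R : realType) (T : R) (N n : nat) : R :=
  n%:R * time_step T N.

(* density x t y u stands for rho(x, t; y, u). *)
Record switching_problem (R : realType) (d D N : nat) := SwitchingProblem {
  horizon : R;
  payoff : 'I_D -> R -> 'rV[R]_d -> R;
  cost : 'I_D -> 'I_D -> R -> 'rV[R]_d -> R;
  density : 'rV[R]_d -> R -> 'rV[R]_d -> R -> R;
  horizon_gt0 : 0 < horizon;
  measurable_payoff : forall j t, 0 <= t <= horizon ->
    measurable_fun setT (payoff j t);
  measurable_cost : forall i j t, 0 <= t <= horizon ->
    measurable_fun setT (cost i j t);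
  cost_diag : forall i t x, 0 <= t <= horizon -> cost i i t x = 0;
  cost_gt0 : forall i j t x, 0 <= t <= horizon -> i != j -> 0 < cost i j t x;
  cost_triangle : forall i j l t x, 0 <= t <= horizon ->
    i != j -> j != l -> i != l -> cost i l t x <= cost i j t x + cost j l t x;
  density_transition : forall n, (n < N)%N ->
    transition_density (fun x y => density x (grid_time horizon N n)
      y (grid_time horizon N n + time_step horizon N))
}.

Definition step_density (R : realType) (d D N : nat)
    (S : switching_problem R d D N) (n : nat) (x y : 'rV[R]_d) : R :=
  density S x (grid_time (horizon S) N n)
    y (grid_time (horizon S) N n + time_step (horizon S) N).

Section estimators.
Context (R : realType) (d D N M m k : nat).
Variables (S : switching_problem R d D N) (nn : knn_rule R d M k).
Variable trunc : nat -> R.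
Local Notation E := 'rV[R]_d.
Variables (xs : 'I_M -> N.+1.-tuple E) (y : nat -> 'I_M -> 'I_m -> E).

Definition points (n : nat) : M.-tuple E := [tuple (xs s)`_n | s < M].

(* max_j [dt f_j - c_ij + c j]; the maximum runs over all j, the seed of the
   iterated maximum being the term j = i. *)
Definition best_switch (n : nat) (i : 'I_D) (x : E) (c : 'I_D -> R) : R :=
  let F j := time_step (horizon S) N * payoff S j (grid_time (horizon S) N n) x
             - cost S i j (grid_time (horizon S) N n) x + c j in
  \big[Num.max/F i]_(j < D) F j.

Definition continuation (n : nat) (v : E -> R) (x : E) : R :=
  \int[rV_lebesgue R d]_z (v z * step_density S n x z).

Definition knn_continuation (n : nat) (v : E -> R) (x : E) : R :=
  (k%:R * m%:R)^-1 *
  \sum_(s in nn (points n) x) \sum_(h < m) v (y n s h).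

Definition truncated_continuation (n : nat) (v : E -> R) (x : E) : R :=
  let c := knn_continuation n v x in
  Num.sg c * Num.min `|c| (2 * trunc n * (enorm x + 1)).

(* Backward recursion, indexed by the number r of steps left to N. *)
Fixpoint value_to_go (r : nat) : 'I_D -> E -> R :=
  match r with
  | 0 => fun _ _ => 0
  | r'.+1 => fun i x => best_switch (N - r'.+1) i x
      (fun j => truncated_continuation (N - r'.+1) (value_to_go r' j) x)
  end.

(* \hat V_i(t_n, x) *)
Definition Vhat (n : nat) (i : 'I_D) (x : E) : R := value_to_go (N - n) i x.

(* \tilde V_i(t_n, x) *)
Definition Vtilde (n : nat) (i : 'I_D) (x : E) : R :=
  best_switch n i x (fun j => continuation n (Vhat n.+1 j) x).

End estimators.

(* p^c_r(x) = P(X_n \notin B(x, r)) *)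
Definition prob_outside (R : realType) (d N : nat)
    disp (Omega : measurableType disp) (P : probability Omega R)
    (X : {RV P >-> N.+1.-tuple 'rV[R]_d}) (n : nat) (r : R) (x : 'rV[R]_d) : R :=
  fine (P [set w | ~ eball x r (X w)`_n]).

Definition covering_bound (R : realType) (d M k : nat) (Q : set 'rV[R]_d)
    (pc : R -> 'rV[R]_d -> R) (C1 C2 delta : R) : R :=
  let tail r := expR (- (M%:R * Num.max
    ((M%:R - k%:R) / M%:R - sup [set pc r x | x in Q]) 0 ^+ 2 / 2)) in
  if delta / C2 <= 1
  then C1 * (fine (volume Q) / delta ^+ d) * tail (delta / (4 * C2))
  else C1 * (fine (volume Q) / delta `^ (d%:R / 2)) *
         tail (Num.sqrt (delta / (4 * C2))).

(* Main.v *)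
(* For a fixed mode j, the truncation can only bring the nearest-neighbour average
   closer to g_j, which grows at most linearly; so the error on Q never exceeds
   a constant and only bounded delta matter. The error splits into a bias,
   controlled by the Lipschitz constant of g_j times the distance from x to its
   k-th neighbour, and an average of k m centred simulations.
   Bias: if it is large, fewer than k samples fall in some ball centred at a
   point of a finite net of Q, which Hoeffding's inequality makes unlikely.
   Average: given the data and the simulations of later times the summands are
   independent, and for sources in a bounded region they have a uniformly
   quadratic log-moment generating function; Chernoff's bound is applied to each
   of the C(M, k) possible sets of neighbours, both signs and all modes.
   Since delta is bounded the sub-Gaussian branch of the maximum suffices. *)

Require Import Defs.
From HB Require Import structures.
From mathcomp Require Import all_boot all_order all_algebra.
From mathcomp Require Import all_classical all_reals all_analysis.
From mathcomp Require Import measurable_realfun zify ring lra.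

Set Implicit Arguments.
Unset Strict Implicit.
Unset Printing Implicit Defensive.

Import Order.TTheory GRing.Theory Num.Theory.
Import numFieldNormedType.Exports.

Local Open Scope classical_set_scope.
Local Open Scope ring_scope.

(** * Euclidean norm *)

(** Two measurability obstacles shape the proof. The value functions at the next time are random:
    they depend on the data and on later simulations, and their growth bound holds only almost
    surely. Clipping them at L(|x|+1) makes the bound hold surely and changes nothing off a null
    set. Conditioning is replaced by integrating the simulations against their densities one
    coordinate at a time, with the data and the later simulations frozen. The supremum over Q need
    not be measurable, so an outer measure is bounded, through finitely many measurable events that
    do not mention x.

    Constants: C0 is the growth constant of g_j. The average is allowed delta/2 and the bias
    delta/4, which leaves room below delta. C2 dominates the error on Q and twice the Lipschitz
    constant there. The Chernoff parameter is optimal for W0, a variance proxy enlarged by C2/scale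
    so that the parameter stays where the moment bound is valid; sigma^2 = 8 W0 / 9 turns the
    resulting 16 W0 into 18 sigma^2. *)

Section euclidean_norm.
Context {R : realType} {d : nat}.
Implicit Types (x y v : 'rV[R]_d).

Lemma enorm_ge0 v : 0 <= enorm v.
Proof. exact: sqrtr_ge0. Qed.

Lemma sqr_enorm v : enorm v ^+ 2 = \sum_i v 0 i ^+ 2.
Proof. by rewrite sqr_sqrtr// sumr_ge0// => i _; exact: sqr_ge0. Qed.

Lemma le_coord_enorm v i : `|v 0 i| <= enorm v.
Proof.
rewrite -ler_sqr ?nnegrE ?enorm_ge0// sqr_enorm (bigD1 i)//= real_normK ?num_real//.
by rewrite lerDl sumr_ge0// => j _; exact: sqr_ge0.
Qed.

Lemma enorm_le_sum v : enorm v <= \sum_i `|v 0 i|.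
Proof.
have s0 : 0 <= \sum_i `|v 0 i| by exact: sumr_ge0.
rewrite -ler_sqr ?nnegrE ?enorm_ge0// sqr_enorm expr2 mulr_suml.
apply: ler_sum => i _; rewrite -[v 0 i ^+ 2]real_normK ?num_real// expr2.
apply: ler_wpM2l => //; rewrite (bigD1 i)//= lerDl; exact: sumr_ge0.
Qed.

Lemma enormN v : enorm (- v) = enorm v.
Proof. by congr Num.sqrt; apply: eq_bigr => i _; rewrite mxE sqrrN. Qed.

Lemma enormB x y : enorm (x - y) = enorm (y - x).
Proof. by rewrite -enormN opprB. Qed.

Lemma enorm0 : enorm (0 : 'rV[R]_d) = 0.
Proof. by rewrite /enorm big1 ?sqrtr0// => i _; rewrite mxE expr0n. Qed.

(** Cauchy-Schwarz by the weighted inequality between x_i y_i and the squares, with weights |y|/|x|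
    and |x|/|y|; a vanishing norm is treated apart because the weights divide by it. *)
Lemma dotp_le x y : \sum_i x 0 i * y 0 i <= enorm x * enorm y.
Proof.
have [x0|x0] := eqVneq (enorm x) 0.
  rewrite x0 mul0r big1// => i _.
  have := le_coord_enorm x i; rewrite x0 normr_le0 => /eqP ->.
  by rewrite mul0r.
have [y0|y0] := eqVneq (enorm y) 0.
  rewrite y0 mulr0 big1// => i _.
  have := le_coord_enorm y i; rewrite y0 normr_le0 => /eqP ->.
  by rewrite mulr0.
have xp : 0 < enorm x by rewrite lt_neqAle eq_sym x0 enorm_ge0.
have yp : 0 < enorm y by rewrite lt_neqAle eq_sym y0 enorm_ge0.
set a := enorm x in x0 xp *; set b := enorm y in y0 yp *.
have -> : a * b = \sum_i (b / a / 2 * x 0 i ^+ 2 + a / b / 2 * y 0 i ^+ 2).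
  rewrite big_split/= -!mulr_sumr -!sqr_enorm -/a -/b.
  by field; rewrite x0 y0.
apply: ler_sum => i _; rewrite -subr_ge0.
have -> : b / a / 2 * x 0 i ^+ 2 + a / b / 2 * y 0 i ^+ 2 - x 0 i * y 0 i =
  (b * x 0 i - a * y 0 i) ^+ 2 / (2 * a * b) by field; rewrite x0 y0.
by rewrite divr_ge0 ?sqr_ge0// !mulr_ge0// ltW.
Qed.

Lemma enormD x y : enorm (x + y) <= enorm x + enorm y.
Proof.
rewrite -ler_sqr ?nnegrE ?addr_ge0 ?enorm_ge0// sqrrD !sqr_enorm.
apply: (@le_trans _ _ (\sum_i (x 0 i ^+ 2 + (x 0 i * y 0 i) *+ 2 + y 0 i ^+ 2))).
  by apply: ler_sum => i _; rewrite mxE sqrrD.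
by rewrite !big_split/= lerD2r lerD2l -mulr2n lerMn2r dotp_le orbT.
Qed.

Lemma enorm_triangle x y z : enorm (x - z) <= enorm (x - y) + enorm (y - z).
Proof. by have := enormD (x - y) (y - z); rewrite addrA subrK. Qed.

Lemma le_enormB x y : enorm y <= enorm x + enorm (x - y).
Proof. by have := enormD x (y - x); rewrite addrC subrK -enormB. Qed.

End euclidean_norm.

(** * Measurability of vector-valued maps *)

Section measurable_vectors.
Context {R : realType} {d : nat} {dT} {T : measurableType dT}.

Lemma measurable_expR_comp (f : T -> R) :
  measurable_fun setT f -> measurable_fun setT (fun x => expR (f x)).
Proof. exact: (measurableT_comp (@measurable_expR R)). Qed.

Lemma measurable_normr_comp (f : T -> R) :
  measurable_fun setT f -> measurable_fun setT (fun x => `|f x|).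
Proof. by move=> mf; exact: measurableT_comp. Qed.

Lemma measurable_exp_decay (a : R) (f : T -> R) :
  measurable_fun setT f -> measurable_fun setT (fun x => expR (- (a * f x))).
Proof.
by move=> mf; apply: measurable_expR_comp; apply: measurable_funN; exact: measurable_funM.
Qed.

Lemma measurable_coord (f : T -> 'rV[R]_d) i :
  measurable_fun setT f -> measurable_fun setT (fun x => f x 0 i).
Proof. by move=> mf; exact: (measurableT_comp (@measurable_rV_coord R d i) mf). Qed.

Lemma measurable_enorm (f : T -> 'rV[R]_d) :
  measurable_fun setT f -> measurable_fun setT (fun x => enorm (f x)).
Proof.
move=> mf; apply: (measurableT_comp (f := @Num.sqrt R)).
  by apply: continuous_measurable_fun; exact: sqrt_continuous.
by apply: measurable_sum => i; apply: measurable_funX; exact: measurable_coord.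
Qed.

Lemma measurable_rVB (f g : T -> 'rV[R]_d) :
  measurable_fun setT f -> measurable_fun setT g ->
  measurable_fun setT (fun x => f x - g x).
Proof.
move=> mf mg; apply: measurable_fun_rV => i.
under eq_fun do rewrite !mxE.
by apply: measurable_funB; exact: measurable_coord.
Qed.

End measurable_vectors.

(** * Exponential integrals over R^d *)

Section exponential_integrals.
Local Open Scope ereal_scope.
Context {R : realType}.
Local Notation mu := (@lebesgue_measure R).

Let measurable_subr (x : R) :
  measurable_fun [set: measurableTypeR R] (fun t => (t - x)%R : measurableTypeR R).
Proof. exact: measurable_funB. Qed.

Let measurable_subl (x : R) :
  measurable_fun [set: measurableTypeR R] (fun t => (x - t)%R : measurableTypeR R).
Proof. exact: measurable_funB. Qed.

(** Lebesgue measure and its image under the translation agree on half-open intervals, hence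
    everywhere. *)
Lemma ge0_integral_subr (f : R -> \bar R) (x : R) :
  measurable_fun setT f -> (forall t, 0 <= f t) ->
  \int[mu]_t f (t - x)%R = \int[mu]_t f t.
Proof.
move=> mf f0.
rewrite -[LHS](ge0_integral_pushforward (measurable_subr x) mu measurableT mf)//.
apply: eq_measure_integral => A mA _; apply/esym/lebesgue_measure_unique => //= _ [[a b]] _ <-.
rewrite /pushforward (_ : _ @^-1` _ = `]a + x, b + x]%classic)%R; last first.
  by apply/seteqP; split => t /=; rewrite !in_itv/= ltrBrDr lerBlDr.
rewrite !lebesgue_measure_itv/= !lte_fin ltrD2r; case: ifP => // _.
by rewrite -!EFinB; congr EFin; ring.
Qed.

Lemma ge0_integral_subl (f : R -> \bar R) (x : R) :
  measurable_fun setT f -> (forall t, 0 <= f t) ->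
  \int[mu]_t f (x - t)%R = \int[mu]_t f t.
Proof.
move=> mf f0.
rewrite -[LHS](ge0_integral_pushforward (measurable_subl x) mu measurableT mf)//.
apply: eq_measure_integral => A mA _; apply/esym/lebesgue_measure_unique => //= _ [[a b]] _ <-.
(* The reflection swaps the open and the closed end of the interval; its length is unchanged. *)
rewrite /pushforward (_ : _ @^-1` _ = `[x - b, x - a[%classic)%R; last first.
  by apply/seteqP; split => t /=; rewrite !in_itv/= ltrBrDl lerBlDl -ltrBrDr -lerBlDr andbC.
rewrite !lebesgue_measure_itv/= !lte_fin ltrD2l ltrN2; case: ifP => // _.
by rewrite -!EFinB; congr EFin; ring.
Qed.

(** The two-sided exponential is dominated by 1/a times the sum of two exponential probability
    densities, one on each side of x. *)
Lemma integral_exp_dist (a x : R) : (0 < a)%R ->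
  \int[mu]_t (expR (- (a * `|x - t|)))%:E <= (2 / a)%:E.
Proof.
move=> a0; have mpdf := measurable_exponential_pdf a.
have pdf0 t := exponential_pdf_ge0 (ltW a0) t.
apply: (@le_trans _ _ (\int[mu]_t (a^-1%:E * ((exponential_pdf a (x - t))%:E +
    (exponential_pdf a (t - x))%:E)))).
  apply: ge0_le_integral => //.
  - apply/measurable_EFinP; apply: measurable_exp_decay.
    by apply: measurable_normr_comp; exact: measurable_funB.
  - apply: measurable_funeM; apply: emeasurable_funD; apply/measurable_EFinP.
      exact: (measurableT_comp mpdf (measurable_subl x)).
    exact: (measurableT_comp mpdf (measurable_subr x)).
  - have pdfE t : (0 <= t -> exponential_pdf a t = a * expR (- (a * t)))%R.
      by move=> t0; rewrite exponential_pdfE// mulNr.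
    move=> t _; rewrite -EFinD -EFinM lee_fin.
    have [xt|/ltW tx] := leP t x.
      rewrite ger0_norm ?subr_ge0// [X in (_ <= _ * (X + _))%R]pdfE ?subr_ge0//.
      rewrite [leRHS]mulrDr mulKf ?gt_eqF// lerDl mulr_ge0// invr_ge0; exact: ltW.
    rewrite ler0_norm ?subr_le0// [X in (_ <= _ * (_ + X))%R]pdfE ?subr_ge0//.
    rewrite [leRHS]mulrDr mulKf ?gt_eqF// opprB lerDr mulr_ge0// invr_ge0; exact: ltW.
rewrite ge0_integralZl//; last 3 first.
- apply: emeasurable_funD; apply/measurable_EFinP.
    exact: (measurableT_comp mpdf (measurable_subl x)).
  exact: (measurableT_comp mpdf (measurable_subr x)).
- by move=> t _; rewrite -EFinD lee_fin addr_ge0.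
- by rewrite lee_fin invr_ge0 ltW.
rewrite ge0_integralD//; last 4 first.
- by move=> t _; rewrite lee_fin.
- by apply/measurable_EFinP; exact: (measurableT_comp mpdf (measurable_subl x)).
- by move=> t _; rewrite lee_fin.
- by apply/measurable_EFinP; exact: (measurableT_comp mpdf (measurable_subr x)).
have mE : measurable_fun setT (EFin \o exponential_pdf a) by exact/measurable_EFinP.
have E0 t : 0 <= (EFin \o exponential_pdf a) t by rewrite lee_fin.
have -> := ge0_integral_subl x mE E0; have -> := ge0_integral_subr x mE E0.
have -> := integral_exponential_pdf a0.
by rewrite -EFinD -EFinM mulrC.
Qed.

Lemma ge0_integral_rV_cons d (f : 'rV[R]_d.+1 -> \bar R) :
  measurable_fun setT f -> (forall v, 0 <= f v) ->
  \int[rV_lebesgue R d.+1]_v f v =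
  \int[mu]_t \int[rV_lebesgue R d]_v f (rV_cons (t, v)).
Proof.
move=> mf f0.
have mcons : measurable_fun [set: measurableTypeR R * 'rV[R]_d]
  (fun p => rV_cons (p : R * 'rV[R]_d)) by exact: measurable_rV_cons.
have E := ge0_integral_pushforward mcons
  (mu \x rV_lebesgue R d)%E measurableT mf (fun v _ => f0 v).
apply: (etrans E); rewrite preimage_setT fubini_tonelli1//.
  by exact: (measurableT_comp mf (@measurable_rV_cons R d)).
by move=> p; exact: f0.
Qed.

Lemma measurable_exp_dist_sum d (a : R) (x : 'rV[R]_d) :
  measurable_fun [set: 'rV[R]_d] (fun y => expR (- (a * \sum_i `|x 0 i - y 0 i|))).
Proof.
apply: measurable_exp_decay; apply: measurable_sum => i.
apply: measurable_normr_comp; apply: measurable_funB => //.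
exact: measurable_rV_coord.
Qed.

(** With the l1 distance the exponential factors over the coordinates, so induction on d reduces to
    the line. *)
Lemma integral_exp_dist_sum d (a : R) (x : 'rV[R]_d) : (0 < a)%R ->
  \int[rV_lebesgue R d]_y (expR (- (a * \sum_i `|x 0 i - y 0 i|)))%:E
  <= ((2 / a) ^+ d)%:E.
Proof.
move=> a0; have a20 : (0 <= 2 / a)%R by rewrite divr_ge0// ltW.
elim: d => [|d IH] in x *.
  rewrite integral_dirac//= ?diracT ?mul1e ?big_ord0 ?mulr0 ?oppr0 ?expR0//.
  by apply/measurable_EFinP; exact: measurable_exp_dist_sum.
rewrite ge0_integral_rV_cons; last 2 first.
- by apply/measurable_EFinP; exact: measurable_exp_dist_sum.
- by move=> v; rewrite lee_fin expR_ge0.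
pose x' : 'rV[R]_d := (\row_i x 0 (lift ord0 i))%R.
have split t v : (expR (- (a * \sum_i `|x 0 i - rV_cons (t, v) 0 i|)) =
    expR (- (a * `|x 0 ord0 - t|)) * expR (- (a * \sum_i `|x' 0 i - v 0 i|)))%R.
  rewrite -expRD -opprD -mulrDr big_ord_recl mxE unlift_none/=.
  do 4 f_equal; apply: eq_bigr => i _.
  by rewrite !mxE liftK.
apply: (@le_trans _ _ (\int[mu]_t (((2 / a) ^+ d)%:E * (expR (- (a * `|x 0 ord0 - t|)))%:E))).
  apply: ge0_le_integral => //.
  - by move=> t _; apply: integral_ge0 => v _; rewrite lee_fin expR_ge0.
  - apply: (@measurable_fun_fubini_tonelli_F _ _ _ _ _ (rV_lebesgue R d)
      (fun p => (expR (- (a * \sum_i `|x 0 i - rV_cons p 0 i|)))%:E)).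
    + apply/measurable_EFinP.
      exact: (measurableT_comp (measurable_exp_dist_sum a x) (@measurable_rV_cons R d)).
    + by move=> p; rewrite lee_fin expR_ge0.
  - apply: measurable_funeM; apply/measurable_EFinP; apply: measurable_exp_decay.
    by apply: measurable_normr_comp; exact: measurable_funB.
  - move=> t _; under eq_integral do rewrite split EFinM.
    rewrite ge0_integralZl//; last first.
      by apply/measurable_EFinP; exact: measurable_exp_dist_sum.
    by rewrite muleC; apply: lee_wpmul2r; rewrite ?lee_fin ?expR_ge0//; exact: IH.
rewrite ge0_integralZl ?lee_fin ?exprn_ge0//; last first.
  apply/measurable_EFinP; apply: measurable_exp_decay.
  by apply: measurable_normr_comp; exact: measurable_funB.
rewrite exprSr EFinM; apply: lee_wpmul2l; first by rewrite lee_fin exprn_ge0.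
exact: integral_exp_dist.
Qed.

Lemma measurable_exp_enorm d (a : R) (x : 'rV[R]_d) :
  measurable_fun [set: 'rV[R]_d] (fun y => expR (- (a * enorm (x - y)))).
Proof.
apply: measurable_exp_decay; apply: measurable_enorm.
exact: measurable_rVB.
Qed.

(** The l1 norm is at most d times the Euclidean one, so the l1 bound applies at rate a/d. *)
Lemma integral_exp_enorm d (a : R) (x : 'rV[R]_d) : (0 < d)%N -> (0 < a)%R ->
  \int[rV_lebesgue R d]_y (expR (- (a * enorm (x - y))))%:E <= ((2 * d%:R / a) ^+ d)%:E.
Proof.
move=> d0 a0; have dR : (0 < d%:R :> R)%R by rewrite ltr0n.
have -> : (2 * d%:R / a = 2 / (a / d%:R))%R by field; rewrite !gt_eqF.
apply: le_trans (integral_exp_dist_sum x _); last by rewrite divr_gt0.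
apply: ge0_le_integral => //.
- by apply/measurable_EFinP; exact: measurable_exp_enorm.
- by apply/measurable_EFinP; exact: measurable_exp_dist_sum.
- move=> y _; rewrite lee_fin ler_expR lerN2 -mulrA; apply: ler_wpM2l; first exact: ltW.
  rewrite ler_pdivrMl//.
  apply: (@le_trans _ _ (\sum_(i < d) enorm (x - y))%R).
    by apply: ler_sum => i _; have := le_coord_enorm (x - y) i; rewrite !mxE.
  by rewrite sumr_const card_ord mulr_natl.
Qed.

End exponential_integrals.

(** * One transition step *)

Section exponential_inequalities.
Context {R : realType}.
Implicit Types u : R.

(** For u >= 1 the last term suffices. For 0 <= u <= 1, multiply (1 - u) exp(u) <= 1 by 1 + u. For u
    <= 0, exp(u) (1 - u) <= 1 and (1 + u + u^2)(1 - u) = 1 - u^3 >= 1. *)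
Lemma expR_le_quadratic u : expR u <= 1 + u + u ^+ 2 * expR `|u|.
Proof.
have [u0|/ltW u0] := leP 0 u.
  rewrite ger0_norm//; have [u1|/ltW u1] := leP 1 u.
    apply: (@le_trans _ _ (u ^+ 2 * expR u)); last by rewrite lerDr addr_ge0.
    by rewrite ler_peMl ?expR_ge0// exprn_ege1.
  have : (1 - u) * expR u <= 1.
    apply: (@le_trans _ _ (expR (- u) * expR u)); last by rewrite -expRD addNr expR0.
    by apply: ler_wpM2r; rewrite ?expR_ge0// expR_ge1Dx.
  move=> /(ler_wpM2l (_ : 0 <= 1 + u)) => /(_ (addr_ge0 ler01 u0)).
  nra.
rewrite ler0_norm//.
have e1 : 1 <= expR (- u) by rewrite -[leLHS]expR0 ler_expR oppr_ge0.
have e2 : 1 - u <= expR (- u) by exact: expR_ge1Dx.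
have e3 : expR u * expR (- u) = 1 by rewrite -expRD subrr expR0.
have e4 : expR u * (1 - u) <= 1 by rewrite -[leRHS]e3; apply: ler_wpM2l; rewrite ?expR_ge0.
have e5 : 0 <= expR u by exact: expR_ge0.
have : u ^+ 2 <= u ^+ 2 * expR (- u) by rewrite ler_peMr ?sqr_ge0.
have : 1 <= (1 + u + u ^+ 2) * (1 - u) by nra.
nra.
Qed.

Lemma sqr_le_expR (u : R) : 0 <= u -> u ^+ 2 <= 2 * expR u.
Proof.
move=> u0; have := expR_ge1Dxn 1 u0; rewrite (_ : 2`! = 2)//.
have := sqr_ge0 u; lra.
Qed.

End exponential_inequalities.

Section transition_step.
Context {R : realType} {d : nat} (d_gt0 : (0 < d)%N).
Local Notation E := 'rV[R]_d.
Local Notation leb := (rV_lebesgue R d).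
Implicit Types (x y u : E) (a : R).

(* exp_mass a and exp_growth a (enorm x + 1) bound the integrals over y of
   exp(-a |x - y|) and of (|y| + 1) exp(-a |x - y|). *)
Definition exp_mass a : R := (2 * d%:R / a) ^+ d.
Definition exp_growth a : R := (1 + 2 / a) * exp_mass (a / 2).

Lemma exp_mass_gt0 a : 0 < a -> 0 < exp_mass a.
Proof. by move=> a0; rewrite exprn_gt0// divr_gt0// mulr_gt0// ltr0n. Qed.

Lemma exp_growth_gt0 a : 0 < a -> 0 < exp_growth a.
Proof.
by move=> a0; rewrite mulr_gt0 ?exp_mass_gt0 ?divr_gt0// addr_gt0// divr_gt0.
Qed.

Lemma growth_shift x y : enorm y + 1 <= (enorm x + 1) * (1 + enorm (x - y)).
Proof. by have := le_enormB x y; have := enorm_ge0 x; have := enorm_ge0 (x - y); nra. Qed.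

(** Half of the decay rate is spent on absorbing the linear factor: 1 + t <= (1 + 2/a) exp(a t /
    2). *)
Lemma growth_exp_decay a x y : 0 < a ->
  (enorm y + 1) * expR (- (a * enorm (x - y))) <=
  (enorm x + 1) * (1 + 2 / a) * expR (- (a / 2 * enorm (x - y))).
Proof.
move=> a0; set t := enorm (x - y); have t0 : 0 <= t by exact: enorm_ge0.
have x0 : 0 <= enorm x by exact: enorm_ge0.
have -> : - (a * t) = - (a / 2 * t) + - (a / 2 * t) by field.
rewrite expRD mulrA; apply: ler_wpM2r; first exact: expR_ge0.
apply: (@le_trans _ _ ((enorm x + 1) * (1 + t) * expR (- (a / 2 * t)))).
  by apply: ler_wpM2r; rewrite ?expR_ge0// growth_shift.
rewrite expRN ler_pdivrMr ?expR_gt0// -[leRHS]mulrA; apply: ler_wpM2l; first exact: addr_ge0.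
have := expR_ge1Dx (a / 2 * t) => /(ler_wpM2l (_ : 0 <= 1 + 2 / a)).
have a2 : 0 <= 2 / a by rewrite divr_ge0// ltW.
move=> /(_ (addr_ge0 ler01 a2)); apply: le_trans.
have -> : (1 + 2 / a) * (1 + a / 2 * t) = 1 + t + (2 / a + a / 2 * t) by field; rewrite gt_eqF.
by rewrite lerDl addr_ge0// mulr_ge0// divr_ge0// ltW.
Qed.

Lemma integral_growth_exp a x : 0 < a ->
  (\int[leb]_y ((enorm y + 1) * expR (- (a * enorm (x - y))))%:E <=
   (exp_growth a * (enorm x + 1))%:E)%E.
Proof.
move=> a0; have x0 : 0 <= (enorm x + 1) * (1 + 2 / a).
  by rewrite mulr_ge0// addr_ge0 ?enorm_ge0// divr_ge0// ltW.
have mexp b := measurable_exp_enorm b x.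
apply: (@le_trans _ _ (\int[leb]_y (((enorm x + 1) * (1 + 2 / a))%:E *
    (expR (- (a / 2 * enorm (x - y))))%:E))%E).
  apply: ge0_le_integral => //.
  - by move=> y _; rewrite lee_fin mulr_ge0 ?expR_ge0// addr_ge0 ?enorm_ge0.
  - apply/measurable_EFinP; apply: measurable_funM => //.
    by apply: measurable_funD => //; exact: measurable_enorm.
  - by apply: measurable_funeM; exact/measurable_EFinP.
  - by move=> y _; rewrite -EFinM lee_fin growth_exp_decay.
rewrite ge0_integralZl ?lee_fin//; last by exact/measurable_EFinP.
apply: (@le_trans _ _ (((enorm x + 1) * (1 + 2 / a))%:E * (exp_mass (a / 2))%:E)%E).
  by apply: lee_wpmul2l; rewrite ?lee_fin//; apply: integral_exp_enorm => //; exact: divr_gt0.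
rewrite -EFinM lee_fin /exp_growth [leRHS]mulrC mulrA; exact: lexx.
Qed.

(** Serves twice: with q the density for the growth of the continuation value, and with q a
    difference of two densities for its Lipschitz estimate. *)
Lemma growth_integrable (v q : E -> R) (L B a : R) x :
  0 <= L -> 0 <= B -> 0 < a ->
  measurable_fun setT v -> measurable_fun setT q ->
  (forall y, `|v y| <= L * (enorm y + 1)) ->
  (forall y, `|q y| <= B * expR (- (a * enorm (x - y)))) ->
  leb.-integrable setT (fun y => (v y * q y)%:E) /\
  `|\int[leb]_y (v y * q y)| <= L * B * exp_growth a * (enorm x + 1).
Proof.
move=> L0 B0 a0 mv mq vL qB.
have mvq : measurable_fun setT (fun y => (v y * q y)%:E : \bar R).
  by apply/measurable_EFinP; exact: measurable_funM.
have mg : measurable_fun setT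
    (fun y => ((enorm y + 1) * expR (- (a * enorm (x - y))))%:E : \bar R).
  apply/measurable_EFinP; apply: measurable_funM; last exact: measurable_exp_enorm.
  by apply: measurable_funD => //; exact: measurable_enorm.
have bnd : (\int[leb]_y `|(v y * q y)%:E| <= (L * B * exp_growth a * (enorm x + 1))%:E)%E.
  apply: (@le_trans _ _ (\int[leb]_y ((L * B)%:E *
      ((enorm y + 1) * expR (- (a * enorm (x - y))))%:E))%E).
    apply: ge0_le_integral => //.
    - exact: measurableT_comp.
    - exact: measurable_funeM.
    - move=> y _; rewrite -EFinM abse_EFin lee_fin normrM.
      rewrite (_ : L * B * _ = (L * (enorm y + 1)) * (B * expR (- (a * enorm (x - y)))));
        last by ring.
      exact: ler_pM.
  rewrite ge0_integralZl ?lee_fin ?mulr_ge0//; last first.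
    by move=> y _; rewrite lee_fin mulr_ge0 ?expR_ge0// addr_ge0 ?enorm_ge0.
  rewrite -(mulrA (L * B) (exp_growth a)) [leRHS]EFinM.
  apply: lee_wpmul2l; first by rewrite lee_fin mulr_ge0.
  exact: integral_growth_exp.
have int_vq : leb.-integrable setT (fun y => (v y * q y)%:E).
  by apply/integrableP; split => //; apply: le_lt_trans bnd _; exact: ltry.
split => //; rewrite -lee_fin; apply: le_trans bnd.
rewrite EFin_normr_Rintegral//; exact: le_abse_integral.
Qed.

Lemma dotp_norm_le (v x : E) : `|\sum_i v 0 i * x 0 i| <= enorm v * enorm x.
Proof.
rewrite ler_norml dotp_le andbT lerNl -(enormN v).
have := dotp_le (- v) x; congr (_ <= _).
by rewrite -sumrN; apply: eq_bigr => i _; rewrite mxE mulNr.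
Qed.

(** Mean value theorem along the segment, then Cauchy-Schwarz; the gradient is controlled only on
    that segment. *)
Lemma gradient_lipschitz (f : E -> R) (x x' : E) (G : R) :
  (forall z, differentiable f z) ->
  (forall t : R, 0 <= t <= 1 -> enorm (gradient f (x + t *: (x' - x))) <= G) ->
  `|f x' - f x| <= G * enorm (x' - x).
Proof.
move=> df gG; set w := x' - x.
pose aff (t : R) : E := x + t *: w.
have daff (t : R) : is_diff (t : R^o) (aff : R^o -> E) (fun s : R^o => (s : R) *: w).
  rewrite (_ : (fun s => _) = cst 0 + (fun s : R^o => (s : R) *: w)); last first.
    by apply/funext => s; rewrite /= !fctE add0r.
  exact: is_diffD.
have dh (t : R) : is_derive (t : R^o) 1 (f \o aff : R^o -> R^o)
    (\sum_i gradient f (aff t) 0 i * w 0 i).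
  have d1 : differentiable (aff : R^o -> E) (t : R^o) by [].
  have d2 : differentiable (f \o aff : R^o -> R^o) (t : R^o).
    exact: differentiable_comp.
  apply: DeriveDef; first exact: diff_derivable.
  rewrite deriveE// diff_comp//= diff_val scale1r [in LHS](row_sum_delta w).
  rewrite linear_sum/=; apply: eq_bigr => i _.
  by rewrite linearZ/= [gradient _ _ _ _]mxE deriveE// mulrC.
have [|t t01] := @MVT_segment R (f \o aff) (fun t => \sum_i gradient f (aff t) 0 i * w 0 i)
    0 1 ler01 (fun t _ => dh t).
  apply: continuous_subspaceT => t.
  have := dh t => -[dht _]; apply: (@differentiable_continuous _ R^o R^o).
  exact/derivable1_diffP.
have xw : x + w = x' by rewrite addrC subrK.
rewrite /= /aff scale1r scale0r addr0 subr0 mulr1 xw => ->.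
apply: le_trans (dotp_norm_le _ _) _; apply: ler_wpM2r; first exact: enorm_ge0.
by apply: gG; rewrite in_itv/= in t01.
Qed.

Variables (l1 l2 L : R) (p : E -> E -> R).
Hypotheses (l1_gt0 : 0 < l1) (l2_gt0 : 0 < l2) (L_gt0 : 0 < L).
Hypothesis p_transition : transition_density p.
Hypothesis p_bounds : forall x y,
  [/\ `|p x y| <= l1^-1 * expR (- (l1 * enorm (x - y))),
      differentiable (p ^~ y) x &
      enorm (gradient (p ^~ y) x) <= l2^-1 * expR (- (l2 * enorm (x - y)))].

Let p_ge0 x y : 0 <= p x y. Proof. by case: p_transition. Qed.

Let measurable_p x : measurable_fun setT (p x).
Proof.
by case: p_transition => mp _ _; exact: (measurable_fun_pair2 (f := fun z => p z.1 z.2)).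
Qed.

Let integral_p x : (\int[leb]_y (p x y)%:E = 1)%E.
Proof. by case: p_transition. Qed.

Definition growth_cst : R := L * l1^-1 * exp_growth l1.
(** The factor [expR l2] is the price of moving the base point of the gradient bound by at most
    1. *)
Definition lipschitz_cst : R := L * (l2^-1 * expR l2) * exp_growth l2.

Lemma growth_cst_gt0 : 0 < growth_cst.
Proof.
rewrite /growth_cst mulr_gt0 ?exp_growth_gt0// mulr_gt0 ?invr_gt0//.
Qed.

Lemma lipschitz_cst_gt0 : 0 < lipschitz_cst.
Proof.
rewrite /lipschitz_cst mulr_gt0 ?exp_growth_gt0// mulr_gt0// mulr_gt0 ?invr_gt0 ?expR_gt0//.
Qed.

(** Every z on the segment satisfies |x - y| <= 1 + |z - y|, so the gradient bound at z is turned
    into decay from x alone. *)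
Lemma density_lipschitz x x' y : enorm (x' - x) <= 1 ->
  `|p x' y - p x y| <= l2^-1 * expR l2 * enorm (x' - x) * expR (- (l2 * enorm (x - y))).
Proof.
move=> xx'; rewrite mulrAC.
apply: (@gradient_lipschitz (p ^~ y)) => [z|t /andP[t0 t1]]; first by case: (p_bounds z y).
case: (p_bounds (x + t *: (x' - x)) y) => _ _ /le_trans; apply.
rewrite -mulrA; apply: ler_wpM2l; first by rewrite invr_ge0 ltW.
rewrite -expRD ler_expR; set z := x + t *: (x' - x).
suff key : enorm (x - y) <= 1 + enorm (z - y).
  by have := ler_wpM2l (ltW l2_gt0) key; rewrite mulrDr mulr1; lra.
apply: le_trans (enorm_triangle x z y) _; rewrite lerD2r enormB /z addrC addrA addNr add0r.
have -> : enorm (t *: (x' - x)) = t * enorm (x' - x).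
  rewrite /enorm -{2}(ger0_norm t0) -sqrtr_sqr -sqrtrM ?sqr_ge0// mulr_sumr.
  by congr Num.sqrt; apply: eq_bigr => i _; rewrite mxE exprMn.
by rewrite -[leRHS]mulr1; apply: ler_pM => //; exact: enorm_ge0.
Qed.

Section one_function.
Variable v : E -> R.
Hypotheses (mv : measurable_fun setT v) (vL : forall y, `|v y| <= L * (enorm y + 1)).

Local Notation cont x := (\int[leb]_z (v z * p x z)).

Let l1V_ge0 : 0 <= l1^-1. Proof. by rewrite invr_ge0 ltW. Qed.

Let cont_growth x : leb.-integrable setT (fun z => (v z * p x z)%:E) /\
  `|cont x| <= growth_cst * (enorm x + 1).
Proof.
apply: (growth_integrable (L := L) (B := l1^-1) (a := l1)) => //; first exact: ltW.
by move=> y; case: (p_bounds x y).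
Qed.

Lemma continuation_growth x : `|cont x| <= growth_cst * (enorm x + 1).
Proof. by have [] := cont_growth x. Qed.

(** The difference is taken under the integral and the Lipschitz estimate applied to the density,
    which avoids differentiating the integral. *)
Lemma continuation_lipschitz x x' : enorm (x' - x) <= 1 ->
  `|cont x' - cont x| <= lipschitz_cst * (enorm x + 1) * enorm (x' - x).
Proof.
move=> xx'; have [ix _] := cont_growth x; have [ix' _] := cont_growth x'.
rewrite -RintegralB//.
have -> : \int[leb]_z (v z * p x' z - v z * p x z) = \int[leb]_z (v z * (p x' z - p x z)).
  by apply: eq_Rintegral => z _; rewrite mulrBr.
have B0 : 0 <= l2^-1 * expR l2 * enorm (x' - x).
  by rewrite !mulr_ge0 ?enorm_ge0 ?expR_ge0// invr_ge0 ltW.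
have mq : measurable_fun setT (fun z => p x' z - p x z) by exact: measurable_funB.
have [_ h] := growth_integrable (ltW L_gt0) B0 l2_gt0 mv mq vL
  (fun y => density_lipschitz y xx').
apply: (le_trans h); rewrite le_eqVlt; apply/orP; left; apply/eqP.
by rewrite /lipschitz_cst; ring.
Qed.

Variables (K : R) (x : E).
Hypothesis xK : enorm x + 1 <= K.

(* Chosen so that step_scale K |v u - cont x| grows in |x - u| at half the rate
   l1 at which the density decays. *)
Definition step_scale (K : R) : R := l1 / (2 * ((L + growth_cst) * K)).

(** Half the variance proxy of one centred simulation. The factor 8 / [step_scale K]^2 comes from
    u^2 <= 2 exp(u) at u = [step_scale K] |dev| / 2, [expR (l1 / 2)] and [l1^-1] from the growth of
    the deviation and the density bound, and [exp_mass (l1 / 2)] from integrating the decay that is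
    left. *)
Definition step_variance (K : R) : R :=
  8 / step_scale K ^+ 2 * expR (l1 / 2) * l1^-1 * exp_mass (l1 / 2).

Local Notation dev u := (v u - cont x).

Lemma step_deviation u : `|dev u| <= (L + growth_cst) * K * (1 + enorm (x - u)).
Proof.
have L0 := ltW L_gt0; have C0 := ltW growth_cst_gt0; have xu := enorm_ge0 (x - u).
apply: le_trans (ler_normB _ _) _; rewrite 2!mulrDl; apply: lerD.
  apply: le_trans (vL u) _; rewrite -mulrA; apply: ler_wpM2l => //.
  apply: le_trans (growth_shift x u) _; apply: ler_wpM2r => //; exact: addr_ge0.
apply: le_trans (continuation_growth x) _; rewrite -mulrA; apply: ler_wpM2l => //.
rewrite mulrDr mulr1; apply: le_trans xK _; rewrite lerDl mulr_ge0//.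
by apply: le_trans xK; rewrite addr_ge0 ?enorm_ge0.
Qed.

Let K_gt0 : 0 < K.
Proof. by apply: lt_le_trans xK; rewrite ltr_wpDl ?enorm_ge0. Qed.

Lemma step_scale_gt0 : 0 < step_scale K.
Proof. by rewrite divr_gt0// !mulr_gt0// addr_gt0// growth_cst_gt0. Qed.

Let scale_dev u : step_scale K * `|dev u| <= l1 / 2 * (1 + enorm (x - u)).
Proof.
have := ler_wpM2l (ltW step_scale_gt0) (step_deviation u); move=> /le_trans; apply.
rewrite mulrA; apply: ler_wpM2r; first by rewrite addr_ge0 ?enorm_ge0.
rewrite /step_scale le_eqVlt; apply/orP; left; apply/eqP; field.
by rewrite gt_eqF//= gt_eqF// addr_gt0// growth_cst_gt0.
Qed.

(** Both exp|a dev| and dev^2 cost at most a factor exp(s |dev| / 2), with s the scale; together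
    they use up half of the decay of the density and leave the rate l1/2. *)
Let expR_dev (a : R) u : `|a| <= step_scale K / 2 ->
  expR (a * dev u) * p x u <= (1 + a * dev u) * p x u +
    a ^+ 2 * (8 / step_scale K ^+ 2 * expR (l1 / 2) * l1^-1) *
    expR (- (l1 / 2 * enorm (x - u))).
Proof.
move: (scale_dev u) step_scale_gt0; move: (step_scale K) => s scale s0 asc.
have := ler_wpM2r (p_ge0 x u) (expR_le_quadratic (a * dev u)).
rewrite [leRHS]mulrDl => /le_trans; apply; rewrite lerD2l.
suff h : dev u ^+ 2 * (expR `|a * dev u| * p x u) <=
    8 / s ^+ 2 * (expR (l1 / 2) * l1^-1) * expR (- (l1 / 2 * enorm (x - u))).
  by have := ler_wpM2l (sqr_ge0 a) h; rewrite exprMn !mulrA.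
have h1 : dev u ^+ 2 <= 8 / s ^+ 2 * expR (s / 2 * `|dev u|).
  have s20 : 0 <= s / 2 by rewrite divr_ge0// ltW.
  have := sqr_le_expR (mulr_ge0 s20 (normr_ge0 (dev u))).
  rewrite exprMn real_normK ?num_real// => h.
  rewrite mulrAC ler_pdivlMr ?exprn_gt0//.
  have -> : dev u ^+ 2 * s ^+ 2 = 4 * ((s / 2) ^+ 2 * dev u ^+ 2) by field.
  lra.
have h2 : expR `|a * dev u| <= expR (s / 2 * `|dev u|).
  by rewrite ler_expR normrM; apply: ler_wpM2r.
have h3 : `|p x u| <= l1^-1 * expR (- (l1 * enorm (x - u))) by case: (p_bounds x u).
rewrite ger0_norm// in h3.
have h4 : expR (s / 2 * `|dev u|) * expR (s / 2 * `|dev u|) <=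
    expR (l1 / 2) * expR (l1 / 2 * enorm (x - u)).
  rewrite -!expRD ler_expR.
  have -> : s / 2 * `|dev u| + s / 2 * `|dev u| = s * `|dev u| by field.
  by apply: le_trans scale _; rewrite mulrDr mulr1.
apply: (@le_trans _ _ ((8 / s ^+ 2 * expR (s / 2 * `|dev u|)) *
    (expR (s / 2 * `|dev u|) * (l1^-1 * expR (- (l1 * enorm (x - u))))))).
  apply: ler_pM => //; first exact: sqr_ge0.
    by rewrite mulr_ge0 ?expR_ge0.
  by apply: ler_pM => //; exact: expR_ge0.
rewrite -!(mulrA (8 / s ^+ 2)); apply: ler_wpM2l.
  by rewrite mulr_ge0// invr_ge0 exprn_ge0// ltW.
rewrite mulrA; have := ler_wpM2r (mulr_ge0 l1V_ge0 (expR_ge0 (- (l1 * enorm (x - u))))) h4.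
move=> /le_trans; apply; rewrite -!(mulrA (expR (l1 / 2))); apply: ler_wpM2l; first exact: expR_ge0.
rewrite mulrCA; apply: ler_wpM2l => //; rewrite -expRD ler_expR.
by rewrite le_eqVlt; apply/orP; left; apply/eqP; field.
Qed.

(* In exp(z) <= 1 + z + z^2 exp|z| the linear term integrates to zero and the
   remainder is controlled by the exponential decay of the density. *)
Lemma step_exp_moment (a : R) : `|a| <= step_scale K / 2 ->
  (\int[leb]_u ((expR (a * dev u))%:E * (p x u)%:E) <=
   (expR (step_variance K * a ^+ 2))%:E)%E.
Proof.
move=> asc; have [iv _] := cont_growth x.
set H := 8 / step_scale K ^+ 2 * expR (l1 / 2) * l1^-1.
have H0 : 0 <= H by rewrite !mulr_ge0 ?expR_ge0// invr_ge0 exprn_ge0// ltW// step_scale_gt0.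
have mdev : measurable_fun setT (fun u => dev u) by exact: measurable_funB.
have mexp := measurable_exp_enorm (l1 / 2) x.
have ip : leb.-integrable setT (fun u => (p x u)%:E).
  apply/integrableP; split; first exact/measurable_EFinP.
  under eq_integral do rewrite abse_EFin ger0_norm//.
  by rewrite integral_p ltry.
have i1 : leb.-integrable setT (fun u => ((1 + a * dev u) * p x u)%:E).
  have -> : (fun u => ((1 + a * dev u) * p x u)%:E) = 
     ((fun u => (1 - a * cont x)%:E * (p x u)%:E) \+ (fun u => a%:E * (v u * p x u)%:E))%E.
    by apply/funext => u; rewrite /= -!EFinM -EFinD; congr EFin; ring.
  by apply: integrableD => //; exact: integrableZl.
have e1 : (\int[leb]_u ((1 + a * dev u) * p x u)%:E = 1)%E.
  transitivity (\int[leb]_u ((1 - a * cont x)%:E * (p x u)%:E + a%:E * (v u * p x u)%:E))%E.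
    by apply: eq_integral => u _; rewrite -!EFinM -EFinD; congr EFin; ring.
  rewrite integralD//; last 2 first.
  - exact: integrableZl.
  - exact: integrableZl.
  rewrite !integralZl// integral_p mule1.
  have -> : (\int[leb]_u (v u * p x u)%:E = (cont x)%:E)%E.
    by rewrite /Rintegral fineK//; exact: integrable_fin_num.
  by rewrite -EFinM -EFinD subrK.
have i2 : leb.-integrable setT
    (fun u => (a ^+ 2 * H)%:E * (expR (- (l1 / 2 * enorm (x - u))))%:E)%E.
  apply: integrableZl => //; apply/integrableP; split; first exact/measurable_EFinP.
  under eq_integral do rewrite abse_EFin ger0_norm ?expR_ge0//.
  apply: le_lt_trans (ltry _); apply: integral_exp_enorm => //; exact: divr_gt0.
apply: (@le_trans _ _ (\int[leb]_u (((1 + a * dev u) * p x u)%:E +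
    (a ^+ 2 * H)%:E * (expR (- (l1 / 2 * enorm (x - u))))%:E))%E).
  apply: ge0_le_integral => //.
  - by move=> u _; rewrite -EFinM lee_fin mulr_ge0 ?expR_ge0.
  - apply: emeasurable_funM; apply/measurable_EFinP => //.
    by apply: measurable_expR_comp; exact: measurable_funM.
  - apply: emeasurable_funD; [exact: (measurable_int _ i1)|exact: (measurable_int _ i2)].
  - by move=> u _; rewrite -!EFinM -EFinD lee_fin; exact: expR_dev.
rewrite integralD// e1 integralZl//; last first.
  apply/integrableP; split; first exact/measurable_EFinP.
  under eq_integral do rewrite abse_EFin ger0_norm ?expR_ge0//.
  apply: le_lt_trans (ltry _); apply: integral_exp_enorm => //; exact: divr_gt0.
apply: (@le_trans _ _ (1 + (a ^+ 2 * H)%:E * (exp_mass (l1 / 2))%:E)%E).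
  apply: leeD => //; apply: lee_wpmul2l; first by rewrite lee_fin mulr_ge0// sqr_ge0.
  by apply: integral_exp_enorm => //; exact: divr_gt0.
rewrite -EFinM -EFinD lee_fin; apply: le_trans (expR_ge1Dx _).
rewrite lerD2l le_eqVlt; apply/orP; left; apply/eqP.
by rewrite /step_variance -/H; ring.
Qed.

End one_function.

(** Tonelli yields measurability for nonnegative integrands only, and [v] changes sign: the integral
    of v + b minus that of b is used, where b is the growth bound. The parameter [t] enters [v] as
    well, because the value function is random. *)
Lemma measurable_continuation dT (T : measurableType dT) (v : T -> E -> R) (x : T -> E) :
  measurable_fun setT (fun z : T * E => v z.1 z.2) ->
  (forall t y, `|v t y| <= L * (enorm y + 1)) -> measurable_fun setT x ->
  measurable_fun setT (fun t => \int[leb]_z (v t z * p (x t) z)).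
Proof.
move=> mv vL mx.
pose b (y : E) := L * (enorm y + 1).
have mb : measurable_fun setT b.
  by apply: measurable_funM => //; apply: measurable_funD => //; exact: measurable_enorm.
have b0 y : 0 <= b y by rewrite mulr_ge0 ?(ltW L_gt0)// addr_ge0 ?enorm_ge0.
have mvt t : measurable_fun setT (v t).
  exact: (measurable_fun_pair2 (f := fun z => v z.1 z.2)).
have mpx : measurable_fun setT (fun z : T * E => p (x z.1) z.2).
  have mz : measurable_fun [set: T * E] (fun z => (x z.1, z.2)).
    by apply: measurable_fun_pair => //; exact: measurableT_comp.
  by case: p_transition => mp _ _; exact: (measurableT_comp mp mz).
have bp z y : `|p z y| <= l1^-1 * expR (- (l1 * enorm (z - y))) by case: (p_bounds z y).
have l1V : 0 <= l1^-1 by rewrite invr_ge0 ltW.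
have iv t : leb.-integrable setT (fun z => (v t z * p (x t) z)%:E).
  by have [] := growth_integrable (ltW L_gt0) l1V l1_gt0 (mvt t) (measurable_p (x t))
    (vL t) (bp (x t)).
have ib t : leb.-integrable setT (fun z => (b z * p (x t) z)%:E).
  have bL y : `|b y| <= L * (enorm y + 1) by rewrite ger0_norm.
  by have [] := growth_integrable (ltW L_gt0) l1V l1_gt0 mb (measurable_p (x t)) bL (bp (x t)).
have -> : (fun t => \int[leb]_z (v t z * p (x t) z)) = (fun t =>
    \int[leb]_z ((v t z + b z) * p (x t) z) - \int[leb]_z (b z * p (x t) z)).
  apply/funext => t; apply/esym/eqP; rewrite subr_eq; apply/eqP.
  rewrite -[RHS](RintegralD measurableT (iv t) (ib t)).
  by apply: eq_Rintegral => z _; rewrite mulrDl.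
have tonelli (f : T -> E -> R) : measurable_fun setT (fun z : T * E => f z.1 z.2) ->
    (forall t z, 0 <= f t z) -> measurable_fun setT (fun t => \int[leb]_z f t z).
  move=> mf f0; apply: (measurableT_comp (@fine_measurable R setT measurableT)) => //.
  apply: (@measurable_fun_fubini_tonelli_F _ _ _ _ _ leb (fun z => (f z.1 z.2)%:E)).
    exact/measurable_EFinP.
  by move=> z; rewrite lee_fin.
have mb2 : measurable_fun setT (fun z : T * E => b z.2) by exact: measurableT_comp.
have tonelliM (f : T -> E -> R) : measurable_fun setT (fun z : T * E => f z.1 z.2) ->
    (forall t z, 0 <= f t z) -> measurable_fun setT (fun t => \int[leb]_z (f t z * p (x t) z)).
  move=> mf f0; have fp0 t z : 0 <= f t z * p (x t) z by exact: mulr_ge0.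
  by apply: (tonelli _ _ fp0); exact: measurable_funM.
apply: (@measurable_funB _ _ _ setT (fun t => \int[leb]_z ((v t z + b z) * p (x t) z))
  (fun t => \int[leb]_z (b z * p (x t) z))); apply: tonelliM.
- exact: measurable_funD.
- by move=> t z; have := vL t z; rewrite ler_norml -subr_ge0 opprK => /andP[].
- by [].
- by move=> t z.
Qed.

End transition_step.

(** * Integrating conditionally independent coordinates *)

Section integrate_coordinates.
Local Open Scope ereal_scope.
Context {dX} {TX : measurableType dX} {dE} {E : measurableType dE} {R : realType}.
Context (m : {sigma_finite_measure set E -> \bar R}) (K : nat).
Variable p : 'I_K -> TX -> E -> R.
Hypotheses (mp : forall j, measurable_fun [set: TX * E] (fun z => p j z.1 z.2))
  (p0 : forall j x y, (0 <= p j x y)%R)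
  (p1 : forall j x, \int[m]_y (p j x y)%:E = 1).
Local Notation T := (TX * K.-tuple E)%type.
Implicit Types (f g : T -> \bar R) (l : seq 'I_K).

Definition tuple_set (y : K.-tuple E) (j : 'I_K) (u : E) : K.-tuple E :=
  [tuple if i == j then u else tnth y i | i < K].

(** Conditional expectation over the j-th coordinate, given the data [z.1] and the other
    coordinates. *)
Definition integrate_coord (j : 'I_K) f (z : T) : \bar R :=
  \int[m]_u (f (z.1, tuple_set z.2 j u) * (p j z.1 u)%:E).

(** The head of the list is the outermost integral. *)
Definition integrate_coords l f : T -> \bar R := foldr integrate_coord f l.

Lemma measurable_tuple_set j :
  measurable_fun [set: T * E] (fun v => (v.1.1, tuple_set v.1.2 j v.2)).
Proof.
apply: measurable_fun_pair; first exact: measurableT_comp.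
apply/measurable_fun_tnthP => i; rewrite /comp.
under eq_fun do rewrite tnth_mktuple.
have [_|_] := eqVneq i j; first exact: measurable_snd.
apply: (measurableT_comp (measurable_tnth i)).
exact: measurableT_comp.
Qed.

Lemma measurable_slice j x : measurable_fun [set: E] (fun u => (p j x u)%:E).
Proof.
apply/measurable_EFinP; exact: (measurable_fun_pair2 (f := fun z => p j z.1 z.2)).
Qed.

Lemma measurable_tuple_set_slice j (z : T) :
  measurable_fun [set: E] (fun u => (z.1, tuple_set z.2 j u)).
Proof. 
exact: (measurable_fun_pair2 (f := fun v => (v.1.1, tuple_set v.1.2 j v.2)) z
  (measurable_tuple_set j)). Qed.

Lemma integrate_coord_ge0 j f : (forall z, 0 <= f z) ->
  forall z, 0 <= integrate_coord j f z.
Proof.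
by move=> f0 z; apply: integral_ge0 => u _; apply: mule_ge0; rewrite ?lee_fin.
Qed.

Lemma measurable_integrate_coord j f : (forall z, 0 <= f z) ->
  measurable_fun setT f -> measurable_fun setT (integrate_coord j f).
Proof.
move=> f0 mf; pose h (v : T * E) := f (v.1.1, tuple_set v.1.2 j v.2) * (p j v.1.1 v.2)%:E.
apply: (@measurable_fun_fubini_tonelli_F _ _ _ _ _ m h).
- apply: emeasurable_funM; first exact: (measurableT_comp mf (measurable_tuple_set j)).
  have mxu : measurable_fun [set: T * E] (fun v => (v.1.1, v.2)).
    by apply: measurable_fun_pair => //; exact: measurableT_comp.
  by apply/measurable_EFinP; exact: (measurableT_comp (mp j) mxu).
- by move=> v; apply: mule_ge0; rewrite ?lee_fin.
Qed.

Lemma integrate_coords_ge0 l f : (forall z, 0 <= f z) ->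
  forall z, 0 <= integrate_coords l f z.
Proof. by move=> f0; elim: l => //= j l IH; exact: integrate_coord_ge0. Qed.

Lemma measurable_integrate_coords l f : (forall z, 0 <= f z) ->
  measurable_fun setT f -> measurable_fun setT (integrate_coords l f).
Proof.
move=> f0 mf; elim: l => //= j l IH; apply: measurable_integrate_coord => //.
exact: integrate_coords_ge0.
Qed.

Lemma measurable_integrand j f z : measurable_fun setT f ->
  measurable_fun [set: E] (fun u => f (z.1, tuple_set z.2 j u) * (p j z.1 u)%:E).
Proof.
move=> mf; apply: emeasurable_funM; last exact: measurable_slice.
exact: (measurableT_comp mf (measurable_tuple_set_slice j z)).
Qed.

Lemma le_integrate_coords l f g : (forall z, 0 <= f z) ->
  measurable_fun setT f -> measurable_fun setT g -> (forall z, f z <= g z) ->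
  forall z, integrate_coords l f z <= integrate_coords l g z.
Proof.
move=> f0 mf mg fg; have g0 z : 0 <= g z by exact: le_trans (f0 z) (fg z).
elim: l => //= j l IH z; apply: ge0_le_integral => //.
- by move=> u _; apply: mule_ge0; rewrite ?lee_fin// integrate_coords_ge0.
- by apply: measurable_integrand; exact: measurable_integrate_coords.
- by apply: measurable_integrand; exact: measurable_integrate_coords.
- by move=> u _; apply: lee_wpmul2r; rewrite ?lee_fin.
Qed.

(** Monotone convergence; it gives the countable additivity of [iterated_law]. *)
Lemma integrate_coords_nneseries l (F : (T -> \bar R)^nat) :
  (forall n z, 0 <= F n z) -> (forall n, measurable_fun setT (F n)) ->
  forall z, integrate_coords l (fun z => \sum_(n <oo) F n z) z =
            \sum_(n <oo) integrate_coords l (F n) z.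
Proof.
move=> F0 mF; elim: l => //= j l IH z.
rewrite /integrate_coord -integral_nneseries//.
- apply: eq_integral => u _; rewrite IH muleC.
  rewrite -nneseriesZl//; first by apply: eq_eseriesr => n _; rewrite muleC.
  by move=> n _; exact: integrate_coords_ge0.
- by move=> n; by apply: measurable_integrand; exact: measurable_integrate_coords.
- by move=> n u _; apply: mule_ge0; rewrite ?lee_fin// integrate_coords_ge0.
Qed.

Lemma integrate_coords_cst l (c : \bar R) z : 0 <= c ->
  integrate_coords l (fun=> c) z = c.
Proof.
move=> c0; elim: l z => //= j l IH z; rewrite /integrate_coord.
under eq_integral do rewrite IH.
rewrite ge0_integralZl ?p1 ?mule1//; first exact: measurable_slice.
by move=> u _; rewrite lee_fin.
Qed.

Definition free_of l f := forall x y j u, j \in l -> f (x, tuple_set y j u) = f (x, y).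

Lemma integrate_coords_pull l f g : (forall z, 0 <= f z) -> (forall z, 0 <= g z) ->
  measurable_fun setT g -> free_of l f ->
  forall z, integrate_coords l (fun z => f z * g z) z = f z * integrate_coords l g z.
Proof.
move=> f0 g0 mg; elim: l => //= j l IH fr z.
rewrite /integrate_coord -ge0_integralZl//.
- apply: eq_integral => u _; rewrite IH; last first.
    by move=> x y i v il; apply: fr; rewrite inE il orbT.
  by rewrite muleA fr ?mem_head//; case: z.
- by apply: measurable_integrand; exact: measurable_integrate_coords.
- by move=> u _; apply: mule_ge0; rewrite ?lee_fin// integrate_coords_ge0.
Qed.

(* Coordinates are integrated out one at a time; factors depending on the
   remaining coordinates are pulled out of the integral. *)
Lemma integrate_coords_prod l (A : set TX) (f : 'I_K -> T -> R) (c : R) :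
  (0 <= c)%R -> uniq l -> (forall j z, (0 <= f j z)%R) ->
  (forall j, measurable_fun setT (f j)) ->
  (forall i j, i \in l -> j \in l -> i != j -> free_of [:: i] (EFin \o f j)) ->
  (forall j x y, j \in l -> A x -> integrate_coord j (EFin \o f j) (x, y) <= c%:E) ->
  forall x y, A x ->
    integrate_coords l (fun z => (\prod_(j <- l) f j z)%R%:E) (x, y) <= (c ^+ size l)%R%:E.
Proof.
move=> c0 + f0 mf; elim: l => /= [_ _ _ x y _|j l IH /andP[jl ul] fr fc x y Ax].
  by rewrite big_nil.
have mprod s : measurable_fun setT (fun z => (\prod_(i <- s) f i z)%R%:E).
  by apply/measurable_EFinP; exact: measurable_prod.
have prod0 s z : 0 <= (\prod_(i <- s) f i z)%R%:E by rewrite lee_fin prodr_ge0.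
have -> : (fun z => (\prod_(i <- j :: l) f i z)%R%:E) =
    (fun z => (f j z)%:E * (\prod_(i <- l) f i z)%R%:E).
  by apply/funext => z; rewrite big_cons EFinM.
have frj : free_of l (EFin \o f j).
  move=> x' y' i u il; apply: (fr i j); rewrite ?mem_head ?inE ?il ?orbT//.
  by apply: contraNneq jl => <-.
(* The bound has to hold for every tuple, since it is used at [tuple_set y j u] under the integral
   over u. *)
have IHl x' y' : A x' -> integrate_coords l (fun z => (\prod_(i <- l) f i z)%R%:E) (x', y')
    <= (c ^+ size l)%R%:E.
  apply: IH => //.
  - by move=> i k il kl; apply: fr; rewrite inE ?il ?kl orbT.
  - by move=> i x'' y'' il; apply: fc; rewrite inE il orbT.
have E0 : integrate_coord j (integrate_coords l
    (fun z => (f j z)%:E * (\prod_(i <- l) f i z)%R%:E)) (x, y) <=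
    (c ^+ size l)%:E * integrate_coord j (EFin \o f j) (x, y).
  rewrite /integrate_coord -ge0_integralZl//; last 3 first.
  - by apply: measurable_integrand; exact/measurable_EFinP.
  - by move=> u _; apply: mule_ge0; rewrite lee_fin.
  - by rewrite lee_fin exprn_ge0.
  apply: ge0_le_integral => //.
  - move=> u _; apply: mule_ge0; rewrite ?lee_fin// integrate_coords_ge0// => z.
    by apply: mule_ge0; rewrite ?lee_fin// prodr_ge0.
  - apply: measurable_integrand; apply: measurable_integrate_coords.
      by move=> z; apply: mule_ge0; rewrite ?lee_fin// prodr_ge0.
    by apply: emeasurable_funM => //; exact/measurable_EFinP.
  - apply: emeasurable_funM => //.
    by apply: measurable_integrand; exact/measurable_EFinP.
  - move=> u _; rewrite muleA; apply: lee_wpmul2r; first by rewrite lee_fin.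
    have -> := integrate_coords_pull (f := EFin \o f j) (l := l) _ _ (mprod l) frj;
      [|by move=> z; rewrite lee_fin|exact: prod0].
    rewrite muleC; apply: lee_wpmul2r; first by rewrite lee_fin.
    exact: IHl.
apply: (le_trans E0); rewrite exprS mulrC EFinM; apply: lee_wpmul2l.
  by rewrite lee_fin exprn_ge0.
by apply: fc; rewrite ?mem_head.
Qed.

Definition coord_prob j (B : set E) (x : TX) : R := (\int[m]_(y in B) p j x y)%R.

Lemma integral_slice_indic j (B : set E) x : measurable B ->
  \int[m]_u ((\1_B u)%:E * (p j x u)%:E) = (coord_prob j B x)%:E.
Proof.
move=> mB; have mpx := measurable_slice j x.
have E1 : \int[m]_u ((\1_B u)%:E * (p j x u)%:E) = \int[m]_(u in B) (p j x u)%:E.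
  rewrite [RHS]integral_mkcond; apply: eq_integral => u _.
  rewrite patchE indicE; case: ifPn => uB; first by rewrite mul1e.
  by rewrite mul0e.
rewrite E1 /coord_prob /Rintegral fineK// ge0_fin_numE; last first.
  by apply: integral_ge0 => u _; rewrite lee_fin.
apply: (@le_lt_trans _ _ 1); last exact: ltry.
rewrite -(p1 j x); apply: ge0_subset_integral => //.
by move=> u _; rewrite lee_fin.
Qed.

Lemma coord_prob_ge0 j B x : (0 <= coord_prob j B x)%R.
Proof. by apply: Rintegral_ge0. Qed.

(** Partially integrated rectangles are kept in closed form so that induction on [l] goes through. A
    repeated index is harmless: the second integration sees a constant. *)
Lemma integrate_coords_rectangle (A : set TX) (B : 'I_K -> set E) l z :
  (forall j, measurable (B j)) ->
  integrate_coords l (fun z => (\1_A z.1 * \prod_j \1_(B j) (tnth z.2 j))%R%:E) z =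
  (\1_A z.1 * \prod_j (if j \in l then coord_prob j (B j) z.1
                       else \1_(B j) (tnth z.2 j)))%R%:E.
Proof.
move=> mB; elim: l z => [|j l IH] [x y]//=.
rewrite /integrate_coord; under eq_integral do rewrite IH/=.
set h := fun i u => if i \in l then coord_prob i (B i) x else \1_(B i) u.
pose r := (\1_A x * \prod_(i < K | i != j) h i (tnth y i))%R.
have r0 : (0 <= r)%R.
  apply: mulr_ge0; first by rewrite indicE.
  by apply: prodr_ge0 => i _; rewrite /h; case: ifP => _; rewrite ?coord_prob_ge0 ?indicE.
have Eh u : (\1_A x * \prod_i h i (tnth (tuple_set y j u) i) = r * h j u)%R.
  rewrite (bigD1 j)//= tnth_mktuple eqxx mulrCA mulrC /r; congr (_ * _ * _)%R.
  by apply: eq_bigr => i /negPf ij; rewrite tnth_mktuple ij.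
transitivity (\int[m]_u (r%:E * ((h j u)%:E * (p j x u)%:E))).
  by apply: eq_integral => u _; rewrite muleA; congr (_ * _); rewrite -EFinM; congr EFin; exact: Eh.
have mh : measurable_fun [set: E] (h j).
  rewrite /h; case: (j \in l); first exact: measurable_cst.
  exact: measurable_indic.
rewrite ge0_integralZl//; last 2 first.
- apply: emeasurable_funM; last exact: measurable_slice.
  exact/measurable_EFinP.
- move=> u _; apply: mule_ge0; rewrite lee_fin// /h.
  by case: ifP => _; rewrite ?coord_prob_ge0 ?indicE.
have -> : \int[m]_u ((h j u)%:E * (p j x u)%:E) = (coord_prob j (B j) x)%:E.
  rewrite /h; case: (j \in l); last exact: integral_slice_indic.
  rewrite ge0_integralZl ?p1 ?mule1//; first exact: measurable_slice.
  - by move=> u _; rewrite lee_fin.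
  - by rewrite lee_fin coord_prob_ge0.
rewrite -EFinM; congr EFin; rewrite [in RHS](bigD1 j)//= mem_head mulrC /r mulrCA.
congr (_ * (_ * _))%R; apply: eq_bigr => i ij.
by rewrite /h inE (negPf ij).
Qed.

Lemma measurable_rectangles : @measurable _ T =
  <<s [set C | exists A B, [/\ measurable A, forall j, measurable (B j) &
         C = [set z : T | A z.1 /\ forall j, B j (tnth z.2 j)]] ] >>.
Proof.
set G := (X in <<s X >>); apply/seteqP; split; last first.
  apply: smallest_sub; first exact: sigma_algebra_measurable.
  move=> _ [A [B [mA mB ->]]].
  rewrite (_ : mkset _ = (fst @^-1` A) `&`
      \big[setI/setT]_(j < K) ((fun z : T => tnth z.2 j) @^-1` B j)); last first.
    rewrite -bigcap_seq; apply/seteqP; split => z /= [Az H]; split => // j.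
      by move=> _; exact: H.
    by apply: (H j); rewrite /= mem_index_enum.
  apply: measurableI.
    by rewrite -[X in measurable X]setTI; exact: measurable_fst.
  apply: bigsetI_measurable => j _; rewrite -[X in measurable X]setTI.
  by apply: (measurableT_comp (measurable_tnth j)) => //; exact: mB.
(* [GT] is the same product with the sigma-algebra generated by the rectangles. The identity from it
   is measurable because each component is, which is the remaining inclusion. *)
pose GT := g_sigma_algebraType G.
have mid : measurable_fun [set: GT] (fun z : GT => (z.1, z.2) : T).
  apply: measurable_fun_pair.
    move=> _ A mA; rewrite setTI; apply: sub_sigma_algebra.
    exists A, (fun=> setT); split => //.
    by apply/seteqP; split => [z|z []].
  apply/measurable_fun_tnthP => i _ D mD; rewrite setTI; apply: sub_sigma_algebra.
  exists setT, (fun j => if j == i then D else setT); split => //.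
    by move=> j; case: ifP.
  apply/seteqP; split => z /=.
    by move=> zD; split => // j; case: eqVneq => // ->.
  by move=> [_ /(_ i)]; rewrite eqxx.
move=> C mC; have := mid measurableT _ mC; rewrite setTI.
by congr (<<s _ >> _); apply/seteqP; split => -[x y].
Qed.

Section law.
Context {dO} {Omega : measurableType dO} (P : probability Omega R).
Variables (X : Omega -> TX) (Y : Omega -> K.-tuple E).
Hypotheses (mX : measurable_fun setT X) (mY : measurable_fun setT Y).
Hypothesis XY_law : forall (A : set TX) (B : 'I_K -> set E),
  measurable A -> (forall j, measurable (B j)) ->
  P [set w | A (X w) /\ forall j, B j (tnth (Y w) j)] =
  \int[P]_(w in X @^-1` A) (\prod_j coord_prob j (B j) (X w))%:E.

Let mXY : measurable_fun setT (fun w => (X w, Y w)).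
Proof. exact: measurable_fun_pair. Qed.

Let indic_EFin_ge0 (C : set T) z : 0 <= (\1_C z)%:E :> \bar R.
Proof. by rewrite lee_fin indicE. Qed.

Let measurable_indic_EFin (C : set T) : measurable C ->
  measurable_fun setT (fun z => (\1_C z)%:E : \bar R).
Proof. by move=> mC; apply/measurable_EFinP; exact: measurable_indic. Qed.

(** Made into a measure so that it can be compared with the joint law on a generating class only. *)
Definition iterated_law l (C : set T) : \bar R :=
  \int[P]_w integrate_coords l (fun z => (\1_C z)%:E) (X w, Y w).

Let iterated_law0 l : iterated_law l set0 = 0.
Proof.
apply: integral0_eq => w _.
rewrite (_ : (fun z => _) = fun=> 0); first exact: integrate_coords_cst.
by apply/funext => z; rewrite indic0.
Qed.

Let iterated_law_ge0 l C : 0 <= iterated_law l C.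
Proof.
by apply: integral_ge0 => w _; exact: integrate_coords_ge0.
Qed.

Let iterated_law_sigma_additive l : semi_sigma_additive (iterated_law l).
Proof.
move=> F mF tF mUF; rewrite /iterated_law.
apply: cvg_toP.
  apply: is_cvg_nneseries => n _ _; exact: iterated_law_ge0.
rewrite (_ : (fun z => (\1_(\bigcup_n F n) z)%:E) =
  (fun z => \sum_(n <oo) (\1_(F n) z)%:E)); last first.
  by apply/funext => z; rewrite indic_bigcup.
have mFi n : measurable_fun setT (fun z => (\1_(F n) z)%:E : \bar R).
  exact: measurable_indic_EFin.
transitivity (\int[P]_w \sum_(n <oo)
    integrate_coords l (fun z => (\1_(F n) z)%:E) (X w, Y w)); last first.
  by apply: eq_integral => w _; rewrite integrate_coords_nneseries.
rewrite integral_nneseries//.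
- move=> n; apply: (measurableT_comp (measurable_integrate_coords _ _ _)) => //.
- by move=> n w _; exact: integrate_coords_ge0.
Qed.

HB.instance Definition _ l := isMeasure.Build _ _ _ (iterated_law l)
  (iterated_law0 l) (iterated_law_ge0 l) (@iterated_law_sigma_additive l).

(** Two finite measures agreeing on the rectangles, which are stable under intersection. Every
    coordinate is overwritten on the right, so [Y w] is a mere placeholder there. *)
Lemma law_integrate_coords l C : (forall j, j \in l) -> measurable C ->
  P [set w | C (X w, Y w)] = \int[P]_w integrate_coords l (fun z => (\1_C z)%:E) (X w, Y w).
Proof.
move=> l_full mC.
pose XY := mfun_Sub (mem_set mXY).
transitivity (pushforward P XY C); first by [].
transitivity (iterated_law l C); last by [].
apply: (measure_unique _ (fun=> setT) measurable_rectangles) => //.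
- move=> _ _ [A [B [mA mB ->]]] [A' [B' [mA' mB' ->]]].
  exists (A `&` A'), (fun j => B j `&` B' j); split.
  + exact: measurableI.
  + by move=> j; exact: measurableI.
  + apply/seteqP; split => z /=.
      by move=> [[? H] [? H']]; split.
    by move=> [[? ?] H]; split; split => // j; have [] := H j.
- move=> _; exists setT, (fun=> setT); split => //.
  by apply/seteqP; split.
- by rewrite bigcup_const//; exists 0%N.
- move=> _ [A [B [mA mB ->]]].
  rewrite /= /pushforward [LHS]/= XY_law// /iterated_law.
  rewrite integral_mkcond; apply: eq_integral => w _.
  have -> : (fun z : T => (\1_[set z : T | A z.1 /\ (forall j, B j (tnth z.2 j))] z)%:E) =
    (fun z => (\1_A z.1 * \prod_j \1_(B j) (tnth z.2 j))%R%:E) :> (T -> \bar R).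
    apply/funext => z; congr EFin; rewrite !indicE.
    have [Az|nAz] := boolP (z.1 \in A); last first.
      by rewrite mul0r memNset// => -[Az _]; move: nAz; rewrite mem_set.
    rewrite mul1r; have [H|H] := pselect (forall j, B j (tnth z.2 j)).
      rewrite mem_set/=; last by split => //; exact: set_mem.
      by rewrite big1// => j _; rewrite indicE mem_set.
    rewrite memNset/=; last by case.
    have [j nB] : exists j, ~ B j (tnth z.2 j) by apply/existsNP.
    by rewrite (bigD1 j)//= indicE memNset// mul0r.
  rewrite integrate_coords_rectangle//= patchE indicE.
  have -> : (w \in X @^-1` A) = (X w \in A) by apply/idP/idP; rewrite !inE.
  case: ifP => _.
    by rewrite mul1r; congr EFin; apply: eq_bigr => j _; rewrite l_full.
  by rewrite mul0r.
- by move=> _; rewrite /= /pushforward preimage_setT probability_setT ltry.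
Qed.

(** [Z j] may depend on coordinates outside [s], here the later simulations. These stay frozen while
    [s] is integrated, and the bound obtained is uniform in them. The sign of [a] selects the
    tail. *)
Lemma chernoff_coords (s : seq 'I_K) (A : set TX) (Z : 'I_K -> T -> R) (a t c : R) :
  uniq s -> measurable A -> (forall j, measurable_fun setT (Z j)) ->
  (forall i j x y u, i \in s -> j \in s -> i != j -> Z j (x, tuple_set y i u) = Z j (x, y)) ->
  (forall j x y, j \in s -> A x ->
     \int[m]_u ((expR (a * Z j (x, tuple_set y j u)))%:E * (p j x u)%:E) <= (expR c)%:E) ->
  measurable [set w | A (X w) /\ (t <= a * \sum_(j <- s) Z j (X w, Y w))%R] /\
  P [set w | A (X w) /\ (t <= a * \sum_(j <- s) Z j (X w, Y w))%R] <=
    (expR (c * (size s)%:R - t))%:E.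
Proof.
move=> us mA mZ Zfree Zexp.
pose S (z : T) := (a * \sum_(j <- s) Z j z)%R.
pose C := [set z : T | A z.1 /\ (t <= S z)%R].
have mS : measurable_fun setT S.
  by apply: measurable_funM => //; exact: measurable_sum.
have mC : measurable C.
  rewrite (_ : C = (fst @^-1` A) `&` (S @^-1` `[t, +oo[%classic)); last first.
    by apply/seteqP; split => z [] /=; rewrite /= in_itv/= andbT.
  by apply: measurableI; rewrite -[X in measurable X]setTI; [exact: measurable_fst|exact: mS].
(* In [l ++ s] the coordinates of [s] are the inner integrals. *)
pose l := [seq j <- enum 'I_K | j \notin s].
have l_full j : j \in l ++ s.
  by rewrite mem_cat mem_filter mem_enum andbT orNb.
split; first by have := mXY measurableT mC; rewrite setTI.
rewrite (law_integrate_coords l_full mC).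
pose f j (z : T) := expR (a * Z j z).
have mf j : measurable_fun setT (f j).
  by apply: (measurableT_comp (@measurable_expR R)); exact: measurable_funM.
pose g (z : T) : \bar R := (\1_A z.1 * expR (- t))%R%:E.
have g0 z : 0 <= g z by rewrite lee_fin mulr_ge0// ?indicE ?expR_ge0.
have mg : measurable_fun setT g.
  apply/measurable_EFinP; apply: measurable_funM => //.
  by apply: measurableT_comp => //; exact: measurable_indic.
pose h (z : T) : \bar R := (\prod_(j <- s) f j z)%R%:E.
have h0 z : 0 <= h z by rewrite lee_fin prodr_ge0// => j _; exact: expR_ge0.
have mh : measurable_fun setT h.
  by apply/measurable_EFinP; exact: measurable_prod.
pose b := (expR (c * (size s)%:R - t))%R.
(* Markov's inequality in pointwise form: on C the exponent is nonnegative, so the indicator is at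
   most g h. The factor g depends on the data only and leaves the integral. *)
have bound z : integrate_coords s (fun z => (\1_C z)%:E) z <= b%:E.
  apply: (@le_trans _ _ (integrate_coords s (fun z => g z * h z) z)).
    apply: le_integrate_coords => //; first exact: measurable_indic_EFin.
      exact: emeasurable_funM.
    move=> v; rewrite /g /h -EFinM lee_fin indicE.
    have [|] := boolP (v \in C); last first.
      move=> _; apply: mulr_ge0; first by apply: mulr_ge0; rewrite ?expR_ge0.
      by apply: prodr_ge0 => j _; exact: expR_ge0.
    rewrite inE => -[Av tS]; rewrite indicE mem_set// mul1r /f -expR_sum -expRD.
    by rewrite -[leLHS]expR0 ler_expR -mulr_sumr addrC subr_ge0.
  rewrite integrate_coords_pull//.
  have [Az|nAz] := pselect (A z.1); last first.
    by rewrite {1}/g indicE memNset// mul0r mul0e lee_fin expR_ge0.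
  apply: (@le_trans _ _ (g z * (expR c ^+ size s)%:E)); last first.
    rewrite /g indicE mem_set// mul1r -EFinM lee_fin -expRM_natr -expRD.
    by rewrite addrC.
  apply: lee_wpmul2l => //; case: z Az => x y /= Ax.
  apply: (integrate_coords_prod (A := A)) => //.
  - by move=> j z; exact: expR_ge0.
  - move=> i j si sj ij x' y' k u; rewrite inE => /eqP ->.
    by rewrite /= /f Zfree.
have -> : integrate_coords (l ++ s) (fun z => (\1_C z)%:E) =
    integrate_coords l (integrate_coords s (fun z => (\1_C z)%:E)).
  by rewrite /integrate_coords foldr_cat.
have <- : \int[P]_w b%:E = b%:E.
  by rewrite integral_cst//= [X in _ * X]probability_setT mule1.
have mI : measurable_fun setT (integrate_coords s (fun z => (\1_C z)%:E)).
  by apply: measurable_integrate_coords => //; exact: measurable_indic_EFin.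
apply: ge0_le_integral => //.
- by move=> w _; apply: integrate_coords_ge0 => z; exact: integrate_coords_ge0.
- apply: (measurableT_comp (measurable_integrate_coords _ _ _)) => //.
  by move=> z; exact: integrate_coords_ge0.
- move=> w _; rewrite -(@integrate_coords_cst l b%:E (X w, Y w)) ?lee_fin ?expR_ge0//.
  apply: le_integrate_coords => //.
  by move=> z; exact: integrate_coords_ge0.
Qed.

End law.
End integrate_coordinates.

(** * Hoeffding bound for the number of distant samples *)

Section binomial_tail.
Context {R : realType}.
Implicit Types p t : R.

(** 16/9 = (4/3)^2, and exp(-1/4) >= 3/4. *)
Lemma expR_half_le : expR (1 / 2) <= 16 / 9 :> R.
Proof.
have h : expR (1 / 4) <= 4 / 3 :> R.
  have := expR_ge1Dx (- (1 / 4) : R); rewrite expRN => h.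
  rewrite -[leLHS]invrK -[leRHS]invrK lef_pV2 ?posrE ?invr_gt0 ?expR_gt0//.
  by apply: le_trans h; lra.
have -> : 1 / 2 = 1 / 4 + 1 / 4 :> R by field.
rewrite expRD; apply: le_trans (ler_pM _ _ h h) _; rewrite ?expR_ge0//; lra.
Qed.

(** The left side is the square of exp(u) - exp(-u) with u = t/2. That difference is at most (16/9 +
    1) u, and (25/9)^2 <= 8. *)
Lemma expR_addN_le t : 0 <= t <= 1 -> expR t + expR (- t) - 2 <= 2 * t ^+ 2.
Proof.
move=> /andP[t0 t1]; set u := t / 2; have tE : t = u + u by rewrite /u; field.
have u0 : 0 <= u by rewrite divr_ge0.
have e1 : expR u * expR (- u) = 1 by rewrite -expRD subrr expR0.
have e2 : 1 - u <= expR (- u) by exact: expR_ge1Dx.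
have e3 : expR u <= 16 / 9.
  by apply: le_trans expR_half_le; rewrite ler_expR /u; lra.
have e4 : 0 <= expR u by exact: expR_ge0.
have e5 : expR u - expR (- u) <= 25 / 9 * u by nra.
have e6 : 0 <= expR u - expR (- u) by rewrite subr_ge0 ler_expR; lra.
rewrite tE opprD !expRD.
have -> : expR u * expR u + expR (- u) * expR (- u) - 2 = (expR u - expR (- u)) ^+ 2.
  transitivity (expR u * expR u + expR (- u) * expR (- u) - 2 * (expR u * expR (- u))).
    by rewrite e1 mulr1.
  by ring.
have : (expR u - expR (- u)) ^+ 2 <= (25 / 9 * u) ^+ 2.
  by rewrite ler_sqr ?nnegrE// (le_trans e6).
move=> /le_trans; apply; have u2 := sqr_ge0 u.
have -> : (25 / 9 * u) ^+ 2 = 625 / 81 * u ^+ 2 by field.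
have -> : (u + u) ^+ 2 = 4 * u ^+ 2 by ring.
lra.
Qed.

(** Jensen's inequality, from the tangent to exp at the mean m = -p t. *)
Lemma expR_neg_le_mix p t : 0 <= p <= 1 -> expR (- (p * t)) <= 1 - p + p * expR (- t).
Proof.
move=> /andP[p0 p1]; set m := - (p * t).
have h1 := ler_wpM2l (expR_ge0 m) (expR_ge1Dx (- m)).
have h2 := ler_wpM2l (expR_ge0 m) (expR_ge1Dx (- t - m)).
rewrite -!expRD subrr expR0 in h1; rewrite -expRD (_ : m + (- t - m) = - t) in h2; last by ring.
have h3 := ler_wpM2l p0 h2.
have h4 := ler_wpM2l (_ : 0 <= 1 - p) h1; rewrite subr_ge0 in h4.
have := lerD (h4 p1) h3; rewrite mulr1; apply: le_trans.
have -> : (1 - p) * (expR m * (1 - m)) + p * (expR m * (1 + (- t - m))) =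
   expR m * (1 - m - p * t) by ring.
by rewrite -addrA /m opprK subrr addr0 mulr1.
Qed.

(* Symmetrisation: E exp(t(b - p)) <= E exp(t(b - b')) for an independent copy b'. *)
Lemma bernoulli_mgf p t : 0 <= p <= 1 -> 0 <= t <= 1 ->
  1 - p + p * expR t <= expR (t * p + t ^+ 2 / 2).
Proof.
move=> p01 t01; have h := expR_neg_le_mix t p01; case/andP: p01 => p0 p1.
have c := expR_addN_le t01.
have m0 : 0 <= 1 - p + p * expR t.
  by rewrite addr_ge0 ?subr_ge0// mulr_ge0// expR_ge0.
have : (1 - p + p * expR t) * expR (- (p * t)) <= expR (t ^+ 2 / 2).
  apply: le_trans (ler_wpM2l m0 h) _; apply: le_trans (expR_ge1Dx _).
  have e : expR t * expR (- t) = 1 by rewrite -expRD subrr expR0.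
  (* The variance p (1 - p) <= 1/4 times 2 t^2 gives t^2 / 2. *)
  have -> : (1 - p + p * expR t) * (1 - p + p * expR (- t)) =
     1 + p * (1 - p) * (expR t + expR (- t) - 2).
    transitivity ((1 - p) ^+ 2 + p ^+ 2 * (expR t * expR (- t)) +
      p * (1 - p) * (expR t + expR (- t))); first ring.
    by rewrite e; ring.
  rewrite lerD2l; apply: le_trans (ler_wpM2l _ c) _; first by rewrite mulr_ge0// subr_ge0.
  have := sqr_ge0 t; have := sqr_ge0 (p - 1 / 2); rewrite !expr2; nra.
move=> /(ler_wpM2r (expR_ge0 (p * t))).
by rewrite -mulrA -!expRD addNr expR0 mulr1 (mulrC t p) [X in _ -> _ <= expR X]addrC.
Qed.

Lemma prod_if_set (M : nat) (J : {set 'I_M}) (x y : R) :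
  \prod_(i < M) (if i \in J then x else y) = x ^+ #|J| * y ^+ (M - #|J|).
Proof.
rewrite (bigID [in J])/=; congr (_ * _).
  by rewrite -prodr_const; apply: eq_bigr => i ->.
have -> : (M - #|J| = #|~: J|)%N by rewrite [RHS]cardsCs finset.setCK card_ord.
by rewrite -prodr_const; apply: eq_big => [i|i /negPf ->//]; rewrite finset.in_setC.
Qed.

(** Chernoff with t = (a - p)_+, which maximises t (a - p) - t^2 / 2 over t >= 0 and never exceeds
    1. The value is the exponent of [covering_bound]. *)
Lemma binomial_sum_tail (M : nat) p (a : R) : 0 <= p <= 1 -> 0 <= a <= 1 ->
  \sum_(I : {set 'I_M} | (a * M%:R <= #|I|%:R)) p ^+ #|I| * (1 - p) ^+ (M - #|I|) <=
  expR (- (M%:R * Num.max (a - p) 0 ^+ 2 / 2)).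
Proof.
move=> p01 /andP[a0 a1]; case/andP: (p01) => p0 p1.
set t := Num.max (a - p) 0.
have t0 : 0 <= t by rewrite le_max lexx orbT.
have t1 : t <= 1 by rewrite ge_max ler01 andbT lerBlDr (le_trans a1)// lerDl.
have tt : t * (a - p) = t ^+ 2.
  by rewrite /t expr2; case: (lerP (a - p) 0) => // _; rewrite !mul0r.
have q0 I : 0 <= p ^+ #|I : {set 'I_M}| * (1 - p) ^+ (M - #|I|).
  by rewrite mulr_ge0// exprn_ge0// subr_ge0.
apply: (@le_trans _ _ (\sum_(I : {set 'I_M}) expR (t * (#|I|%:R - a * M%:R)) *
    (p ^+ #|I| * (1 - p) ^+ (M - #|I|)))).
  rewrite [leRHS](bigID (fun I : {set 'I_M} => a * M%:R <= #|I|%:R))/=.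
  rewrite -[leLHS]addr0; apply: lerD; last first.
    by apply: sumr_ge0 => I _; rewrite mulr_ge0 ?expR_ge0.
  apply: ler_sum => I aI; rewrite -[leLHS]mul1r; apply: ler_wpM2r => //.
  by rewrite -[leLHS]expR0 ler_expR mulr_ge0// subr_ge0.
have -> : \sum_(I : {set 'I_M}) expR (t * (#|I|%:R - a * M%:R)) *
    (p ^+ #|I| * (1 - p) ^+ (M - #|I|)) =
    expR (- (t * a * M%:R)) * (1 - p + p * expR t) ^+ M.
  transitivity (expR (- (t * a * M%:R)) * \prod_(i < M) (p * expR t + (1 - p))); last first.
    by rewrite prodr_const card_ord addrC.
  rewrite bigA_distr mulr_sumr; apply: eq_bigr => I _.
  have -> : expR (t * (#|I|%:R - a * M%:R)) = expR (- (t * a * M%:R)) * expR t ^+ #|I|.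
    by rewrite -expRM_natr -expRD; congr expR; ring.
  by rewrite prod_if_set exprMn -!mulrA; congr (_ * _); rewrite mulrCA.
apply: (@le_trans _ _ (expR (- (t * a * M%:R)) * expR (t * p + t ^+ 2 / 2) ^+ M)).
  apply: ler_wpM2l; first exact: expR_ge0.
  apply: lerXn2r; rewrite ?nnegrE ?expR_ge0//.
    by rewrite addr_ge0 ?subr_ge0// mulr_ge0// expR_ge0.
  by apply: bernoulli_mgf => //; rewrite t0.
rewrite -expRM_natr -expRD ler_expR le_eqVlt; apply/orP; left; apply/eqP.
have -> : - (M%:R * t ^+ 2 / 2) = - (M%:R * (t * (a - p))) + M%:R * t ^+ 2 / 2.
  by rewrite tt; field.
ring.
Qed.

End binomial_tail.

(** * Union bounds, also for outer measures *)

Section finite_union_bound.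
Local Open Scope ereal_scope.
Context {dO} {Omega : measurableType dO} {R : realType} (P : {measure set Omega -> \bar R}).

Lemma measure_bigsetU_le (I : finType) (c : pred I) (B : I -> set Omega) :
  (forall i, c i -> measurable (B i)) ->
  P (\big[setU/set0]_(i | c i) B i) <= \sum_(i | c i) P (B i).
Proof.
move=> mB.
have [] : measurable (\big[setU/set0]_(i | c i) B i) /\
    P (\big[setU/set0]_(i | c i) B i) <= \sum_(i | c i) P (B i); last by [].
apply: (big_ind2 (fun X y => measurable X /\ P X <= y)).
- by rewrite measure0.
- move=> X x Y y [mX Xx] [mY Yy]; split; first exact: measurableU.
  by apply: le_trans (measureU2 _ mX mY) _; exact: leeD.
- by move=> i ci; split => //; exact: mB.
Qed.

(** [A] is not assumed measurable; the exceptional set is enlarged to a measurable null set before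
    subadditivity is used. *)
Lemma mu_ext_finite_cover_le (I : finType) (A N : set Omega) (B : I -> set Omega) :
  P.-negligible N -> (forall i, measurable (B i)) ->
  (forall w, A w -> ~ N w -> exists i, B i w) ->
  mu_ext P A <= \sum_i P (B i).
Proof.
move=> [N' [mN' N'0 NN']] mB AB.
have mU : measurable (\big[setU/set0]_i B i) by exact: bigsetU_measurable.
apply: (@le_trans _ _ (mu_ext P (N' `|` \big[setU/set0]_i B i))).
  apply: le_mu_ext => w Aw; have [Nw|Nw] := pselect (N w); first by left; exact: NN'.
  by right; have [i Bi] := AB _ Aw Nw; rewrite -bigcup_seq; exists i => //=; rewrite mem_index_enum.
rewrite measurable_mu_extE; last exact: measurableU.
apply: le_trans (measureU2 _ mN' mU) _; rewrite -[leRHS]add0e; apply: leeD.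
  by rewrite le_eqVlt; apply/orP; left; apply/eqP; exact: N'0.
exact: measure_bigsetU_le.
Qed.

End finite_union_bound.

(** * Number of independent samples in a set *)

Section independent_count.
Context {dO} {Omega : measurableType dO} {R : realType} (P : probability Omega R).
Context {dT} {T : measurableType dT} (M : nat) (Z : 'I_M -> Omega -> T).
Hypothesis mZ : forall s, measurable_fun setT (Z s).
Hypothesis Z_indep : forall A : 'I_M -> set T, (forall s, measurable (A s)) ->
  P [set w | forall s, A s (Z s w)] = (\prod_(s < M) fine (P (Z s @^-1` A s)))%:E.
Variables (U : set T) (p : R).
Hypotheses (mU : measurable U) (pE : forall s, P (Z s @^-1` U) = p%:E).

Lemma independent_count_tail (a : R) : 0 <= a <= 1 -> (0 < M)%N ->
  measurable [set w | (a * M%:R <= #|[set s | Z s w \in U]%SET|%:R)] /\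
  (P [set w | (a * M%:R <= #|[set s | Z s w \in U]%SET|%:R)%R] <=
    (expR (- (M%:R * Num.max (a - p) 0 ^+ 2 / 2)))%:E)%E.
Proof.
move=> a01 M0.
(* The samples in U are exactly those of index in I; by independence this has probability p^|I| (1 -
   p)^(M - |I|). *)
pose B (I : {set 'I_M}) := [set w | forall s, (if s \in I then U else ~` U) (Z s w)].
have mpre s A : measurable A -> measurable (Z s @^-1` A).
  by move=> mA; rewrite -[X in measurable X]setTI; exact: mZ.
have mif (I : {set 'I_M}) s : measurable (if s \in I then U else ~` U).
  by case: ifP => // _; exact: measurableC.
have mB I : measurable (B I).
  rewrite (_ : B I = \big[setI/setT]_(s < M) (Z s @^-1` (if s \in I then U else ~` U))).
    by apply: bigsetI_measurable => s _; exact: mpre.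
  rewrite -bigcap_seq; apply/seteqP; split => w /= H s; first by move=> _; exact: H.
  by apply: (H s); rewrite /= mem_index_enum.
have Bcount w : B [set s | Z s w \in U]%SET w.
  move=> s; rewrite finset.in_set; case: ifPn; first by rewrite inE.
  by move=> /negP; rewrite inE.
have countB I w : B I w -> [set s | Z s w \in U]%SET = I.
  move=> BI; apply/setP => s; rewrite finset.in_set; have := BI s.
  by case: ifP => _; [exact: mem_set|exact: memNset].
have eE : [set w | (a * M%:R <= #|[set s | Z s w \in U]%SET|%:R)] =
    \big[setU/set0]_(I : {set 'I_M} | a * M%:R <= #|I|%:R) B I.
  rewrite -bigcup_seq_cond; apply/seteqP; split => w /=.
    by move=> aw; exists [set s | Z s w \in U]%SET => //=; rewrite mem_index_enum.
  by move=> [I /= /andP[_ aI] /countB ->].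
have p01 : 0 <= p <= 1.
  by rewrite -!lee_fin -(pE (Ordinal M0)) measure_ge0 probability_le1//; exact: mpre.
split; first by rewrite eE; apply: bigsetU_measurable.
rewrite eE; have := @measure_bigsetU_le _ _ _ P _ (fun I : {set 'I_M} => a * M%:R <= #|I|%:R) B
  (fun I _ => mB I); move=> /le_trans; apply.
have h := binomial_sum_tail M p01 a01.
rewrite -lee_fin -sumEFin in h; apply: le_trans h.
apply: lee_sum => I _; rewrite [leLHS](Z_indep (mif I)) -prod_if_set lee_fin le_eqVlt.
apply/orP; left; apply/eqP; apply: eq_bigr => s _; case: ifP => _; first by rewrite pE.
rewrite preimage_setC probability_setC ?pE//; exact: mpre.
Qed.

End independent_count.

(** * Nets of bounded sets *)

Section covering.
Context {R : realType} {d : nat}.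
Local Notation E := 'rV[R]_d.

Lemma bounded_set_coord (Q : set E) : bounded_set Q ->
  exists2 R0 : R, 0 < R0 & forall x, Q x -> forall i, `|x 0 i| <= R0.
Proof.
move=> /pinfty_ex_gt0[R0 R00 QR]; exists R0 => // x Qx i.
apply: le_trans (QR x Qx); rewrite [leRHS]mx_normrE.
by rewrite (le_trans _ (le_bigmax _ _ (0, i))).
Qed.

(** Makes [fine (volume Q)] the true volume, so that the constant C1 may be divided by it. *)
Lemma volume_lty (Q : set E) : bounded_set Q -> (volume Q < +oo)%E.
Proof.
move=> /bounded_set_coord[R0 R00 QR].
pose a : E := const_mx (- R0); pose b : E := const_mx R0.
pose box := [set v : E | forall i, a 0 i <= v 0 i <= b 0 i].
have mbox : measurable box.
  rewrite (_ : box = \big[setI/setT]_(i < d)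
      (@rV_coord R d i @^-1` `[a 0 i, b 0 i]%classic)); last first.
    rewrite -bigcap_seq; apply/seteqP; split => v /= H i.
      by move=> _; rewrite /= in_itv/=; exact: H.
    by have /= := H i; rewrite in_itv/=; apply; rewrite mem_index_enum.
  apply: bigsetI_measurable => i _.
  by rewrite -[X in measurable X]setTI; exact: measurable_rV_coord.
apply: (@le_lt_trans _ _ (mu_ext (rV_lebesgue R d) box)).
  by apply: le_mu_ext => x Qx i; rewrite !mxE -ler_norml; exact: QR.
have ab i : a 0 i <= b 0 i by rewrite !mxE -subr_ge0 opprK addr_ge0// ltW.
by rewrite measurable_mu_extE// [X in (X < _)%E](rV_lebesgue_box ab) ltry.
Qed.

(* Cut space into cubes of side r/(2d) and keep one point of Q in each cube
   meeting Q: this keeps the centres of the net inside Q. *)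
Lemma bounded_set_net (Q : set E) : (0 < d)%N -> bounded_set Q ->
  exists2 C : R, 0 < C & forall r, 0 < r <= 1 ->
    exists (n : nat) (c : 'I_n -> E),
      [/\ forall k, Q (c k), forall x, Q x -> exists k, enorm (x - c k) < r &
          n%:R <= C / r ^+ d].
Proof.
move=> d0 /bounded_set_coord[R0 R00 QR].
have dR : 0 < d%:R :> R by rewrite ltr0n.
exists ((4 * d%:R * R0 + 1) ^+ d).
  by rewrite exprn_gt0// addr_gt0// !mulr_gt0.
move=> r /andP[r0 r1]; pose h := r / (2 * d%:R).
have h0 : 0 < h by rewrite divr_gt0// mulr_gt0.
(* Shifted by R0, the coordinates of points of Q lie in [0, 2 R0], so the cell indices stay below K
   and [inord] does not alter them. *)
pose K := (Num.truncn (2 * R0 / h)).+1.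
pose cell (x : E) : {ffun 'I_d -> 'I_K} := [ffun i => inord (Num.truncn ((x 0 i + R0) / h))].
pose J : {set {ffun 'I_d -> 'I_K}} := [set k | `[< exists x, Q x /\ cell x = k >]]%SET.
(* The default 0 is never taken: J contains only cells that meet Q. *)
pose c (k : 'I_#|J|) : E := xget 0 [set x | Q x /\ cell x = enum_val k].
have cP k : Q (c k) /\ cell (c k) = enum_val k.
  have : enum_val k \in J by exact: enum_valP.
  rewrite finset.in_set => /asboolP[x Qx]; rewrite /c.
  exact: (@xgetPex _ 0 [set x | Q x /\ cell x = enum_val k] (ex_intro _ x Qx)).
exists #|J|, c; split => [k|x Qx|]; first by case: (cP k).
- have xJ : cell x \in J by rewrite finset.in_set; apply/asboolP; exists x.
  exists (enum_rank_in xJ (cell x)).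
  set k := enum_rank_in _ _; have [Qc] := cP k; rewrite enum_rankK_in// => cc.
  apply: le_lt_trans (enorm_le_sum _) _.
  apply: (@le_lt_trans _ _ (\sum_(i < d) h)); last first.
    rewrite sumr_const card_ord -mulr_natr /h -mulrA invfM -mulrA mulVf ?gt_eqF// mulr1.
    by rewrite ltr_pdivrMr// ltr_pMr// ltr1n.
  apply: ler_sum => i _; rewrite !mxE.
  have bnd (y : E) : Q y -> 0 <= (y 0 i + R0) / h <= 2 * R0 / h.
    move=> /QR/(_ i); rewrite ler_norml => /andP[y1 y2].
    apply/andP; split; first by apply: divr_ge0; [lra|exact: ltW].
    by rewrite ler_pM2r ?invr_gt0//; lra.
  have tr (y : E) : Q y -> (Num.truncn ((y 0 i + R0) / h))%:R <= (y 0 i + R0) / h <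
      (Num.truncn ((y 0 i + R0) / h)).+1%:R.
    by move=> /bnd/andP[? _]; rewrite truncn_itv.
  have /ffunP/(_ i) := cc; rewrite !ffunE => /(congr1 val)/=.
  rewrite !inordK; last 2 first.
  - by rewrite ltnS le_truncn//; case/andP: (bnd x Qx).
  - by rewrite ltnS le_truncn//; case/andP: (bnd _ Qc).
  move=> e; have /andP[a1 a2] := tr _ Qx; have /andP[a3 a4] := tr _ Qc.
  rewrite e in a3 a4; set q := (Num.truncn _)%:R in a1 a3.
  rewrite -natr1 ltr_pdivrMr// -/q in a2; rewrite -natr1 ltr_pdivrMr// -/q in a4.
  rewrite ler_pdivlMr// in a1; rewrite ler_pdivlMr// in a3.
  rewrite mulrDl mul1r in a2; rewrite mulrDl mul1r in a4.
  by rewrite ler_norml; apply/andP; split; lra.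
- apply: (@le_trans _ _ ((K ^ d)%N%:R)).
    rewrite ler_nat; apply: leq_trans (max_card _) _.
    by rewrite card_ffun !card_ord.
  rewrite natrX -expr_div_n lerXn2r ?nnegrE//.
    by rewrite divr_ge0 ?addr_ge0 ?mulr_ge0// ltW.
  rewrite ler_pdivlMr// -[K%:R]natr1.
  (* Hence K r <= 4 d R0 + r, and r <= 1 makes the bound uniform. *)
  have : (Num.truncn (2 * R0 / h))%:R <= 2 * R0 / h.
    by rewrite truncn_le divr_ge0 ?mulr_ge0// ltW.
  move=> /(ler_wpM2r (ltW r0)).
  have -> : 2 * R0 / h * r = 4 * d%:R * R0 by rewrite /h; field; rewrite !gt_eqF.
  by move=> hK; rewrite [leLHS]mulrDl mul1r; exact: lerD.
Qed.

End covering.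

(** * Measurability of the estimators *)

Section measurable_scalar.
Context {R : realType} {dT} {T : measurableType dT}.

Lemma measurable_sg (f : T -> R) :
  measurable_fun setT f -> measurable_fun setT (fun t => Num.sg (f t)).
Proof.
move=> mf; rewrite /Num.sg.
apply: measurable_fun_ifT => //; first exact: measurable_fun_eqr.
by apply: measurable_fun_ifT => //; exact: measurable_fun_ltr.
Qed.

Lemma measurable_bigmax (I : Type) (s : seq I) (f0 : T -> R) (f : I -> T -> R) :
  measurable_fun setT f0 -> (forall i, measurable_fun setT (f i)) ->
  measurable_fun setT (fun t => \big[Num.max/f0 t]_(i <- s) f i t).
Proof.
move=> mf0 mf; elim: s => [|i s IH]; first by under eq_fun do rewrite big_nil.
by under eq_fun do rewrite big_cons; exact: measurable_maxr.
Qed.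

End measurable_scalar.

Section estimator_regularity.
Context {R : realType} {d D N M m k : nat}.
Variables (S : switching_problem R d D N) (nn : knn_rule R d M k) (trunc : nat -> R).
Local Notation E := 'rV[R]_d.

Lemma grid_time_range n : (n <= N)%N -> (0 < N)%N ->
  0 <= grid_time (horizon S) N n <= horizon S.
Proof.
move=> nN N0; have T0 := horizon_gt0 S; have NR : 0 < N%:R :> R by rewrite ltr0n.
rewrite /grid_time /time_step; apply/andP; split.
  by rewrite mulr_ge0// divr_ge0// ltW.
by rewrite mulrCA ler_piMr ?(ltW T0)// ler_pdivrMr// mul1r ler_nat.
Qed.

(** Values depend only on simulations issued from their own time on. This makes the next value
    insensitive to the simulations being averaged, and lets the simulations be replaced by a finite
    tuple. *)
Lemma eq_value_to_go (xs : 'I_M -> N.+1.-tuple E) (y y' : nat -> 'I_M -> 'I_m -> E) r :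
  (r <= N)%N ->
  (forall n, (N - r <= n < N)%N -> forall s h, y n s h = y' n s h) ->
  value_to_go S nn trunc xs y r = value_to_go S nn trunc xs y' r.
Proof.
elim: r => //= r IH rN yy'; apply/funext => i; apply/funext => x.
congr best_switch; apply/funext => j.
have e : value_to_go S nn trunc xs y r = value_to_go S nn trunc xs y' r.
  by apply: IH => [|n /andP[n1 n2] s h]; [exact: ltnW|apply: yy'; rewrite n2 andbT; lia].
suff e2 : knn_continuation nn xs y (N - r.+1) (value_to_go S nn trunc xs y r j) x =
    knn_continuation nn xs y' (N - r.+1) (value_to_go S nn trunc xs y' r j) x.
  by rewrite /truncated_continuation e2.
rewrite /knn_continuation; congr (_ * _); apply: eq_bigr => s _; apply: eq_bigr => h _.
by rewrite e yy'//; lia.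
Qed.

Section measurability.
Context {dT} {T : measurableType dT}.
Variables (xs : T -> 'I_M -> N.+1.-tuple E) (y : T -> nat -> 'I_M -> 'I_m -> E).
Hypotheses (mxs : forall s, measurable_fun setT (fun t => xs t s))
  (my : forall n s h, measurable_fun setT (fun t => y t n s h)).

Lemma measurable_position n s : (n <= N)%N -> measurable_fun setT (fun t => (xs t s)`_n).
Proof.
move=> nN; have e t : (xs t s)`_n = tnth (xs t s) (inord n) by rewrite (tnth_nth 0) inordK.
under eq_fun do rewrite e.
exact: (measurableT_comp (measurable_tnth _) (mxs s)).
Qed.

Lemma measurable_nn n (x : T -> E) I : (n <= N)%N -> measurable_fun setT x ->
  measurable [set t | nn (points (xs t) n) (x t) = I].
Proof.
move=> nN mx; rewrite -[X in measurable X]setTI.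
have mz : measurable_fun setT (fun t => (points (xs t) n, x t)).
  apply: measurable_fun_pair => //; apply/measurable_fun_tnthP => s.
  rewrite /comp; under eq_fun do rewrite tnth_mktuple.
  exact: measurable_position.
exact: (mz measurableT _ (knn_measurable nn I)).
Qed.

Lemma measurable_in_nn n (x : T -> E) s : (n <= N)%N -> measurable_fun setT x ->
  measurable_fun setT (fun t => s \in nn (points (xs t) n) (x t)).
Proof.
move=> nN mx; apply: (measurable_fun_bool true).
rewrite setTI (_ : _ @^-1` _ = \big[setU/set0]_(I : {set 'I_M} | s \in I)
   [set t | nn (points (xs t) n) (x t) = I]); last first.
  rewrite -bigcup_seq_cond; apply/seteqP; split => t /=.
    by move=> st; exists (nn (points (xs t) n) (x t)) => //=; rewrite mem_index_enum.
  by move=> [I /= /andP[_ sI] ->].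
by apply: bigsetU_measurable => I _; exact: measurable_nn.
Qed.

(** The evaluation point varies with t because the recursion evaluates the next value at simulated
    points. *)
Lemma measurable_value_to_go r i (x : T -> E) : (r <= N)%N -> measurable_fun setT x ->
  measurable_fun setT (fun t => value_to_go S nn trunc (xs t) (y t) r i (x t)).
Proof.
elim: r i x => [|r IH] i x rN mx /=; first exact: measurable_cst.
have nN : (N - r.+1 <= N)%N by exact: leq_subr.
have N0 : (0 < N)%N by exact: leq_trans rN.
have gt := grid_time_range nN N0.
have mF j : measurable_fun setT (fun t =>
    time_step (horizon S) N * payoff S j (grid_time (horizon S) N (N - r.+1)) (x t) -
    cost S i j (grid_time (horizon S) N (N - r.+1)) (x t) +
    truncated_continuation nn trunc (xs t) (y t) (N - r.+1)
      (value_to_go S nn trunc (xs t) (y t) r j) (x t)).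
  apply: measurable_funD.
    apply: measurable_funB; last exact: (measurableT_comp (measurable_cost i j gt) mx).
    apply: measurable_funM => //; exact: (measurableT_comp (measurable_payoff j gt) mx).
  have mc : measurable_fun setT (fun t => knn_continuation nn (xs t) (y t) (N - r.+1)
      (value_to_go S nn trunc (xs t) (y t) r j) (x t)).
    apply: measurable_funM => //; under eq_fun do rewrite big_mkcond/=.
    apply: measurable_sum => s; apply: measurable_fun_ifT => //.
      exact: measurable_in_nn.
    by apply: measurable_sum => h; apply: IH => //; exact: ltnW.
  apply: measurable_funM; first exact: measurable_sg.
  apply: measurable_minr; first exact: measurable_normr_comp.
  by apply: measurable_funM => //; apply: measurable_funD => //; exact: measurable_enorm.
exact: measurable_bigmax.
Qed.

End measurability.
End estimator_regularity.

(** * Splitting the one-step error *)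

Section truncation.
Context {R : realType}.

(* The truncation of truncated_continuation. *)
Definition clip (b c : R) : R := Num.sg c * Num.min `|c| b.

Lemma clip_id b c : `|c| <= b -> clip b c = c.
Proof. by move=> cb; rewrite /clip min_l// -numEsg. Qed.

Lemma clip_norm_le b c : 0 <= b -> `|clip b c| <= b.
Proof.
move=> b0; rewrite /clip normrM [X in _ * X]ger0_norm ?le_min ?normr_ge0//.
apply: (@le_trans _ _ (1 * b)); last by rewrite mul1r.
apply: ler_pM => //; first by rewrite le_min normr_ge0.
  by rewrite normr_sg; case: (_ != _).
by rewrite ge_min lexx orbT.
Qed.

(** Clipping is the projection onto [-b, b]: it is nonexpansive and fixes g. *)
Lemma clip_dist_le b c g : `|g| <= b -> `|clip b c - g| <= `|c - g|.
Proof.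
rewrite /clip ler_norml => /andP[g1 g2].
have [cb|/ltW bc] := leP `|c| b; first by rewrite -numEsg.
have b0 : 0 <= b by lra.
have [c0|c0|->] := ltgtP c 0; last by rewrite sgr0 mul0r.
- rewrite ltr0_sg// mulN1r; rewrite ltr0_norm// in bc.
  by rewrite ler0_norm ?ler0_norm; lra.
- rewrite gtr0_sg// mul1r; rewrite gtr0_norm// in bc.
  by rewrite ger0_norm ?ger0_norm; lra.
Qed.

Lemma measurable_clip dT (T : measurableType dT) (b c : T -> R) :
  measurable_fun setT b -> measurable_fun setT c ->
  measurable_fun setT (fun t => clip (b t) (c t)).
Proof.
move=> mb mc; apply: measurable_funM; first exact: measurable_sg.
by apply: measurable_minr => //; exact: measurable_normr_comp.
Qed.

Lemma bigmax_dist_le (I : Type) (s : seq I) (f g : I -> R) (f0 g0 b : R) :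
  `|f0 - g0| <= b -> (forall i, `|f i - g i| <= b) ->
  `|\big[Num.max/f0]_(i <- s) f i - \big[Num.max/g0]_(i <- s) g i| <= b.
Proof.
move=> fg0 fg; elim: s => [|i s]; first by rewrite !big_nil.
rewrite !big_cons; move: (\big[_/_]_(_ <- _) _) (\big[_/_]_(_ <- _) _) => x y xy.
have := fg i; move: xy; rewrite !ler_norml => /andP[h1 h2] /andP[h3 h4].
by case: (leP (f i) y) => ?; case: (leP (g i) x) => ?; apply/andP; split; lra.
Qed.

End truncation.

Section nearest_neighbours.
Context {R : realType} {d M k : nat} (nn : knn_rule R d M k).
Local Notation E := 'rV[R]_d.

(** A selected point farther than 2r would force all points of the ball, at least k of them, to be
    selected besides it, which makes more than k. *)
Lemma knn_dist_le (pts : M.-tuple E) (x z : E) (r : R) :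
  enorm (x - z) < r -> (k <= #|[set s | `[< eball z r (tnth pts s) >]]%SET|)%N ->
  forall s, s \in nn pts x -> enorm (tnth pts s - x) <= r + r.
Proof.
move=> xz; set J := [set s | _]%SET => kJ s sn; rewrite leNgt; apply/negP => far.
have close s' : s' \in J -> enorm (tnth pts s' - x) < r + r.
  rewrite finset.in_set => /asboolP; rewrite /eball/= => h.
  apply: le_lt_trans (enorm_triangle _ z _) _.
  by rewrite (enormB z x); exact: ltrD.
have sJ : s \notin J by apply/negP => /close /lt_trans /(_ far); rewrite ltxx.
have : J \subset (nn pts x :\ s)%SET.
  apply/fintype.subsetP => s' s'J; rewrite !inE; apply/andP; split.
    by apply: contraNneq sJ => <-.
  apply/negPn/negP => s'n; have := knn_nearest sn s'n.
  move=> /le_lt_trans /(_ (close _ s'J)) /lt_trans /(_ far).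
  by rewrite ltxx.
move=> /subset_leq_card; rewrite leqNgt => /negP; apply.
have := cardsD1 s (nn pts x); rewrite sn knn_card add1n => e.
by apply: leq_trans kJ; rewrite [X in (_ <= X)%N]e.
Qed.

End nearest_neighbours.

Section one_step_error.
Context {R : realType} {d D N M m k : nat}.
Variables (S : switching_problem R d D N) (nn : knn_rule R d M k) (trunc : nat -> R).
Local Notation E := 'rV[R]_d.
Variables (xs : 'I_M -> N.+1.-tuple E) (y : nat -> 'I_M -> 'I_m -> E).
Variables (n : nat) (n_lt : (n < N)%N) (v : 'I_D -> E -> R) (C0 : R).
Hypotheses (vE : forall j, Vhat S nn trunc xs y n.+1 j = v j)
  (truncE : trunc n = C0) (C0_ge0 : 0 <= C0)
  (g_growth : forall j x, `|continuation S n (v j) x| <= C0 * (enorm x + 1)).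
Local Notation g j x := (continuation S n (v j) x).

Lemma Vhat_step i x : Vhat S nn trunc xs y n i x =
  best_switch S n i x (fun j => clip (2 * C0 * (enorm x + 1)) (knn_continuation nn xs y n (v j) x)).
Proof.
rewrite /Vhat; have -> : (N - n = (N - n.+1).+1)%N by lia.
rewrite /=; have -> : (N - (N - n.+1).+1 = n)%N by lia.
congr best_switch; apply/funext => j.
by rewrite /truncated_continuation truncE -vE.
Qed.

Lemma Vhat_error i x b :
  (forall j, `|clip (2 * C0 * (enorm x + 1)) (knn_continuation nn xs y n (v j) x) - g j x| <= b) ->
  `|Vhat S nn trunc xs y n i x - Vtilde S nn trunc xs y n i x| <= b.
Proof.
move=> h; rewrite Vhat_step /Vtilde /best_switch.
by apply: bigmax_dist_le => [|j]; rewrite /= opprD addrACA subrr add0r vE; exact: h.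
Qed.

(** 2 C0 from the truncation level and C0 from the growth of g_j. *)
Lemma Vhat_error_growth i x :
  `|Vhat S nn trunc xs y n i x - Vtilde S nn trunc xs y n i x| <= 3 * C0 * (enorm x + 1).
Proof.
apply: Vhat_error => j; apply: le_trans (ler_normB _ _) _.
have x0 : 0 <= C0 * (enorm x + 1) by rewrite mulr_ge0// addr_ge0 ?enorm_ge0.
have c0 : 0 <= 2 * C0 * (enorm x + 1) by rewrite -mulrA mulr_ge0.
by have := clip_norm_le (knn_continuation nn xs y n (v j) x) c0; have := g_growth j x; lra.
Qed.

Lemma Vhat_error_split i x (b1 b2 : R) : (0 < k)%N -> (0 < m)%N ->
  (forall j, `|(k%:R * m%:R)^-1 *
     \sum_(s in nn (points xs n) x) \sum_(h < m) (v j (y n s h) - g j (xs s)`_n)| <= b1) ->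
  (forall j s, s \in nn (points xs n) x -> `|g j (xs s)`_n - g j x| <= b2) ->
  `|Vhat S nn trunc xs y n i x - Vtilde S nn trunc xs y n i x| <= b1 + b2.
Proof.
move=> k_gt0 m_gt0 h1 h2; apply: Vhat_error => j.
have x0 : 0 <= C0 * (enorm x + 1) by rewrite mulr_ge0// addr_ge0 ?enorm_ge0.
apply: le_trans (clip_dist_le _ _) _; first by apply: le_trans (g_growth j x) _; lra.
have km : 0 < k%:R * m%:R :> R by rewrite mulr_gt0// ltr0n.
have -> : knn_continuation nn xs y n (v j) x - g j x =
    (k%:R * m%:R)^-1 * \sum_(s in nn (points xs n) x) \sum_(h < m) (v j (y n s h) - g j (xs s)`_n) +
    (k%:R * m%:R)^-1 * \sum_(s in nn (points xs n) x) \sum_(h < m) (g j (xs s)`_n - g j x).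
  rewrite -mulrDr -big_split/=.
  under [in RHS]eq_bigr do (rewrite -big_split/=; under eq_bigr do rewrite addrA subrK).
  under [in RHS]eq_bigr do rewrite sumrB sumr_const card_ord.
  rewrite sumrB sumr_const knn_card mulrBr; congr (_ - _).
  rewrite -mulrnA -[X in _^-1 * X]mulr_natr natrM (mulrC (g j x)) mulrA (mulrC m%:R).
  by rewrite mulVf ?mul1r// gt_eqF.
apply: le_trans (ler_normD _ _) _; apply: lerD => //.
rewrite normrM ger0_norm ?invr_ge0 ?(ltW km)// ler_pdivrMl//.
apply: le_trans (ler_norm_sum _ _ _) _.
apply: (@le_trans _ _ (\sum_(s in nn (points xs n) x) \sum_(h < m) b2)).
  apply: ler_sum => s sn; apply: le_trans (ler_norm_sum _ _ _) _.
  by apply: ler_sum => h _; exact: h2.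
by rewrite !sumr_const card_ord knn_card -[leLHS]mulr_natl -[b2 *+ m]mulr_natl mulrA.
Qed.

End one_step_error.

(** * Deviation of the simulation averages *)

Section conditional_deviation.
Context {R : realType} {d D N M m k : nat}.
Local Notation E := 'rV[R]_d.
Local Notation leb := (rV_lebesgue R d).
Local Notation TX := (M.-tuple (N.+1.-tuple E)).

(* The simulations issued from the times n < N are packed into one tuple, whose
   i-th entry has time sim_time i and source sim_source i. *)
Definition sim_index : finType := ('I_N * 'I_M * 'I_m)%type.
Local Notation K := #|{: sim_index}|.

Definition sim_time (i : 'I_K) : 'I_N := (enum_val i : sim_index).1.1.
Definition sim_source (i : 'I_K) : 'I_M := (enum_val i : sim_index).1.2.
Definition sim_rank (n : 'I_N) (s : 'I_M) (h : 'I_m) : 'I_K := enum_rank ((n, s, h) : sim_index).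

(** The value 0 for n >= N is harmless: the recursion reads only times before N. *)
Definition sims_of (y : K.-tuple E) (n : nat) (s : 'I_M) (h : 'I_m) : E :=
  if insub n is Some n0 then tnth y (sim_rank n0 s h) else 0.

Definition tuple_of_sims (y : nat -> 'I_M -> 'I_m -> E) : K.-tuple E :=
  [tuple y (sim_time i) (sim_source i) (enum_val i : sim_index).2 | i < K].

Lemma sims_of_tuple y n s h : (n < N)%N -> sims_of (tuple_of_sims y) n s h = y n s h.
Proof.
move=> nN; rewrite /sims_of insubT tnth_mktuple /sim_time /sim_source /sim_rank.
by rewrite enum_rankK.
Qed.

Variables (S : switching_problem R d D N).

Definition sim_density (i : 'I_K) (x : TX) (u : E) : R :=
  step_density S (sim_time i) (tnth x (sim_source i))`_(sim_time i) u.

Lemma step_transition n : (n < N)%N -> transition_density (step_density S n).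
Proof. exact: density_transition. Qed.

Let measurable_position_tuple (s : 'I_M) n : (n <= N)%N ->
  measurable_fun setT (fun x : TX => (tnth x s)`_n).
Proof.
move=> nN; apply: (@measurable_position R d N M _ TX (fun x s => tnth x s)) => // s'.
exact: measurable_tnth.
Qed.

Lemma measurable_sim_density i :
  measurable_fun [set: TX * E] (fun z => sim_density i z.1 z.2).
Proof.
have [mp _ _] := step_transition (ltn_ord (sim_time i)).
have mz : measurable_fun [set: TX * E] (fun z => ((tnth z.1 (sim_source i))`_(sim_time i), z.2)).
  apply: measurable_fun_pair => //.
  exact: (measurableT_comp (measurable_position_tuple _ (ltnW (ltn_ord _))) measurable_fst).
exact: (measurableT_comp mp mz).
Qed.

Lemma sim_density_ge0 i x u : 0 <= sim_density i x u.
Proof. by have [_ p0 _] := step_transition (ltn_ord (sim_time i)); exact: p0. Qed.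

Lemma integral_sim_density i x : (\int[leb]_u (sim_density i x u)%:E = 1)%E.
Proof. by have [_ _ p1] := step_transition (ltn_ord (sim_time i)); exact: p1. Qed.

Context {dO} {Omega : measurableType dO} (P : probability Omega R).
Variables (Xs : 'I_M -> {RV P >-> N.+1.-tuple E}) (Y : nat -> 'I_M -> 'I_m -> {RV P >-> E}).
Hypothesis simulations : conditional_simulations (step_density S) Xs Y.

Definition data_tuple w : TX := [tuple Xs s w | s < M].
Definition sims_tuple w : K.-tuple E := tuple_of_sims (fun n s h => Y n s h w).

Lemma measurable_data_tuple : measurable_fun setT data_tuple.
Proof.
apply/measurable_fun_tnthP => s; rewrite /comp.
by under eq_fun do rewrite tnth_mktuple; exact: measurable_funP.
Qed.

Lemma measurable_sims_tuple : measurable_fun setT sims_tuple.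
Proof.
apply/measurable_fun_tnthP => i; rewrite /comp.
by under eq_fun do rewrite tnth_mktuple; exact: measurable_funP.
Qed.

Lemma sims_law (A : set TX) (B : 'I_K -> set E) :
  measurable A -> (forall i, measurable (B i)) ->
  (P [set w | A (data_tuple w) /\ forall i, B i (tnth (sims_tuple w) i)] =
   \int[P]_(w in data_tuple @^-1` A)
     (\prod_i coord_prob leb sim_density i (B i) (data_tuple w))%:E)%E.
Proof.
move=> mA mB.
have h := simulations mA (fun n s h => mB (sim_rank n s h)).
rewrite (_ : mkset _ = [set w | A [tuple Xs s w | s < M] /\
    forall (n : 'I_N) s h, B (sim_rank n s h) (Y n s h w)]); last first.
  apply/seteqP; split => w /= [Aw H]; split => //.
    move=> n s h'; have := H (sim_rank n s h').
    by rewrite tnth_mktuple /sim_time /sim_source /sim_rank enum_rankK.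
  move=> i; rewrite tnth_mktuple; have := H (sim_time i) (sim_source i) (enum_val i : sim_index).2.
  by rewrite /sim_rank /sim_time /sim_source -!surjective_pairing enum_valK.
rewrite h; apply: eq_integral => w _; congr EFin.
rewrite pair_bigA pair_bigA/= (reindex (enum_val : 'I_K -> sim_index))/=; last first.
  exact/onW_bij/enum_val_bij.
apply: eq_bigr => i _; rewrite /coord_prob /transition_prob /sim_density tnth_mktuple.
by rewrite /sim_rank /sim_time /sim_source -!surjective_pairing enum_valK.
Qed.

Variables (nn : knn_rule R d M k) (trunc : nat -> R) (l1 l2 L : R) (n : nat).
Hypotheses (d_gt0 : (0 < d)%N) (n_lt : (n < N)%N).
Hypotheses (l1_gt0 : 0 < l1) (l2_gt0 : 0 < l2) (L_gt0 : 0 < L).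
Hypothesis p_bounds : forall x y,
  [/\ `|step_density S n x y| <= l1^-1 * expR (- (l1 * enorm (x - y))),
      differentiable (step_density S n ^~ y) x &
      enorm (gradient (step_density S n ^~ y) x) <= l2^-1 * expR (- (l2 * enorm (x - y)))].

(* Agrees almost surely with Vhat at time n.+1, but satisfies the linear growth
   bound everywhere. *)
Definition clipped_value (z : TX * K.-tuple E) (j : 'I_D) (x : E) : R :=
  clip (L * (enorm x + 1)) (Vhat S nn trunc (tnth z.1) (sims_of z.2) n.+1 j x).

Lemma clipped_value_growth z j x : `|clipped_value z j x| <= L * (enorm x + 1).
Proof. by apply: clip_norm_le; rewrite mulr_ge0 ?(ltW L_gt0)// addr_ge0 ?enorm_ge0. Qed.

Lemma measurable_sims_of n' s h : measurable_fun setT (fun y : K.-tuple E => sims_of y n' s h).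
Proof.
rewrite /sims_of; case: insub => [n0|]; first exact: measurable_tnth.
exact: measurable_cst.
Qed.

Lemma measurable_clipped_value j :
  measurable_fun setT (fun z : (TX * K.-tuple E) * E => clipped_value z.1 j z.2).
Proof.
apply: measurable_clip.
  by apply: measurable_funM => //; apply: measurable_funD => //; exact: measurable_enorm.
apply: (@measurable_value_to_go R d D N M m k S nn trunc _ _
  (fun z => tnth z.1.1) (fun z => sims_of z.1.2)) => //.
- by move=> s; apply: (measurableT_comp (measurable_tnth s)); exact: measurableT_comp.
- move=> n' s h; apply: (measurableT_comp (measurable_sims_of n' s h)); exact: measurableT_comp.
- exact: leq_subr.
Qed.

Lemma measurable_clipped_value_slice z j : measurable_fun setT (clipped_value z j).
Proof.
exact: (measurable_fun_pair2 (f := fun u => clipped_value u.1 j u.2) z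
  (measurable_clipped_value j)).
Qed.

(* The value at time n.+1 only involves simulations issued from times > n. *)
Lemma clipped_value_free x y i u : sim_time i = n :> nat ->
  clipped_value (x, tuple_set y i u) = clipped_value (x, y).
Proof.
move=> tin; apply/funext => j; apply/funext => v; rewrite /clipped_value/= /Vhat.
rewrite (@eq_value_to_go R d D N M m k S nn trunc _ (sims_of (tuple_set y i u)) (sims_of y))//.
  exact: leq_subr.
move=> n' /andP[n1 n2] s h; rewrite /sims_of insubT tnth_mktuple; case: eqP => // e.
by move: tin; rewrite -e /sim_time /sim_rank enum_rankK/=; lia.
Qed.

(** The source is read at time n whatever the time of [i]; only indices of time n, those of
    [sims_from], are summed. *)
Definition sim_deviation (j : 'I_D) (i : 'I_K) (z : TX * K.-tuple E) : R :=
  clipped_value z j (tnth z.2 i) -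
  continuation S n (clipped_value z j) (tnth z.1 (sim_source i))`_n.

Lemma measurable_sim_deviation j i : measurable_fun setT (sim_deviation j i).
Proof.
apply: measurable_funB.
  have mz : measurable_fun setT (fun z : TX * K.-tuple E => (z, tnth z.2 i)).
    apply: measurable_fun_pair => //.
    exact: (measurableT_comp (measurable_tnth i) measurable_snd).
  exact: (measurableT_comp (measurable_clipped_value j) mz).
apply: (measurable_continuation d_gt0 l1_gt0 L_gt0 (step_transition n_lt) p_bounds
  (v := fun z => clipped_value z j)).
- exact: measurable_clipped_value.
- by move=> z y; exact: clipped_value_growth.
- exact: (measurableT_comp (measurable_position_tuple (sim_source i) (ltnW n_lt)) measurable_fst).
Qed.

Definition sims_from (I : {set 'I_M}) : seq 'I_K :=
  [seq sim_rank (Ordinal n_lt) s h | s <- enum I, h <- enum 'I_m].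

Lemma mem_sims_from I i : i \in sims_from I -> sim_time i = n :> nat /\ sim_source i \in I.
Proof.
move=> /allpairsP[[s h]] /= [sI _ ->]; rewrite mem_enum in sI.
by rewrite /sim_time /sim_source /sim_rank enum_rankK.
Qed.

Lemma sims_from_uniq I : uniq (sims_from I).
Proof.
apply: allpairs_uniq; rewrite ?enum_uniq// => -[s h] [s' h'] _ _ /=.
by move=> /enum_rank_inj[-> ->].
Qed.

Lemma size_sims_from I : size (sims_from I) = (#|I| * m)%N.
Proof. by rewrite size_allpairs -cardE size_enum_ord. Qed.

Variable K0 : R.
Local Notation scale := (@step_scale R d l1 L K0).
Local Notation variance := (@step_variance R d l1 L K0).

(** The neighbours of x are replaced by a fixed index set, so x disappears. The first conjunct
    confines the sources to a region where one moment bound serves all, and it depends on the data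
    only. *)
Definition deviation_event (j : 'I_D) (I : {set 'I_M}) (a t : R) : set Omega :=
  [set w | (forall s, s \in I -> enorm ((Xs s w)`_n) + 1 <= K0) /\
    t <= a * \sum_(s in I) \sum_(h < m)
      (clipped_value (data_tuple w, sims_tuple w) j (Y n s h w) -
       continuation S n (clipped_value (data_tuple w, sims_tuple w) j) (Xs s w)`_n)].

Lemma deviation_event_bound j I a t : `|a| <= scale / 2 ->
  measurable (deviation_event j I a t) /\
  (P (deviation_event j I a t) <= (expR (variance * a ^+ 2 * (#|I| * m)%:R - t))%:E)%E.
Proof.
move=> asc.
pose A : set TX := [set x : TX | forall s, s \in I -> enorm ((tnth x s)`_n) + 1 <= K0].
have mA : measurable A.
  rewrite (_ : A = \big[setI/setT]_(s in I)
      ((fun x : TX => enorm ((tnth x s)`_n) + 1) @^-1` `]-oo, K0]%classic)).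
    apply: bigsetI_measurable => s _; rewrite -[X in measurable X]setTI.
    have mf : measurable_fun setT (fun x : TX => enorm ((tnth x s)`_n) + 1).
      apply: measurable_funD => //; apply: measurable_enorm.
      exact: measurable_position_tuple (ltnW n_lt).
    exact: mf.
  rewrite -bigcap_seq_cond; apply/seteqP; split => x /= H s.
    by move=> /andP[_ sI]; rewrite /= in_itv/=; exact: H.
  by move=> sI; have := H s; rewrite /= mem_index_enum in_itv/= => -> //.
have := @chernoff_coords _ TX _ E R leb K sim_density measurable_sim_density
  sim_density_ge0 integral_sim_density _ Omega P data_tuple sims_tuple
  measurable_data_tuple measurable_sims_tuple sims_law (sims_from I) A
  (fun i => sim_deviation j i) a t (variance * a ^+ 2)
  (sims_from_uniq I) mA (measurable_sim_deviation j).
rewrite size_sims_from.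
have -> : [set w | A (data_tuple w) /\
    t <= a * \sum_(i <- sims_from I) sim_deviation j i (data_tuple w, sims_tuple w)] =
    deviation_event j I a t.
  have e w : \sum_(i <- sims_from I) sim_deviation j i (data_tuple w, sims_tuple w) =
      \sum_(s in I) \sum_(h < m)
      (clipped_value (data_tuple w, sims_tuple w) j (Y n s h w) -
       continuation S n (clipped_value (data_tuple w, sims_tuple w) j) (Xs s w)`_n).
    rewrite big_allpairs_dep big_enum/=; apply: eq_bigr => s sI.
    rewrite big_enum/=; apply: eq_bigr => h _.
    rewrite /sim_deviation /= !tnth_mktuple /sim_time /sim_source /sim_rank.
    by rewrite enum_rankK.
  apply/seteqP; split => w /= [Aw]; rewrite e => tw; split => // s /Aw; rewrite tnth_mktuple//.
apply.
(* Another simulation of time n affects neither the next value function nor the coordinate i'. *)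
- move=> i i' x y u /mem_sims_from[ti _] _ ii'; rewrite /sim_deviation/= clipped_value_free//.
  by rewrite tnth_mktuple; rewrite eq_sym (negPf ii').
- move=> i x y /mem_sims_from[ti si] Ax.
  have sdev u : sim_deviation j i (x, tuple_set y i u) = clipped_value (x, y) j u -
      continuation S n (clipped_value (x, y) j) (tnth x (sim_source i))`_n.
    by rewrite /sim_deviation/= clipped_value_free// tnth_mktuple eqxx.
  have sd u : sim_density i x u = step_density S n (tnth x (sim_source i))`_n u.
    by rewrite /sim_density ti.
  under eq_integral do rewrite sdev sd.
  apply: (step_exp_moment d_gt0 l1_gt0 L_gt0 (step_transition n_lt) p_bounds) => //.
  + exact: measurable_clipped_value_slice.
  + exact: clipped_value_growth.
  + exact: Ax.
Qed.

End conditional_deviation.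

(** * The one-step estimate *)

Section outside_ball.
Context {R : realType} {d N M : nat}.
Local Notation E := 'rV[R]_d.
Context {d1} {Omega1 : measurableType d1} {P1 : probability Omega1 R}
  {X : {RV P1 >-> N.+1.-tuple E}}.
Context {dO} {Omega : measurableType dO} {P : probability Omega R}
  {Xs : 'I_M -> {RV P >-> N.+1.-tuple E}}.
Hypothesis copies : independent_copies X Xs.
Variables (n : nat) (n_le : (n <= N)%N).

Definition outside_count (c : E) (r : R) (w : Omega) : nat :=
  #|[set s | `[< ~ eball c r (Xs s w)`_n >]]%SET|.

Let U (c : E) (r : R) : set (N.+1.-tuple E) := [set x : N.+1.-tuple E | ~ eball c r x`_n].

Let measurable_U c r : measurable (U c r).
Proof.
have mf : measurable_fun setT (fun x : N.+1.-tuple E => enorm (x`_n - c)).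
  apply: measurable_enorm; apply: measurable_rVB => //.
  have e (x : N.+1.-tuple E) : x`_n = tnth x (inord n) by rewrite (tnth_nth 0) inordK.
  by under eq_fun do rewrite e; exact: measurable_tnth.
rewrite (_ : U c r = (fun x : N.+1.-tuple E => enorm (x`_n - c)) @^-1` `[r, +oo[%classic).
  by rewrite -[X in measurable X]setTI; exact: mf.
by apply/seteqP; split => x /=; rewrite /U /eball /= in_itv/= andbT leNgt => /negP.
Qed.

Lemma prob_outside_fin c r : P1 [set w | ~ eball c r (X w)`_n] = (prob_outside X n r c)%:E.
Proof.
rewrite /prob_outside fineK//; apply: fin_num_measure.
exact: (measurable_funPTI X (measurable_U c r)).
Qed.

Lemma prob_outside_le1 c r : prob_outside X n r c <= 1.
Proof.
rewrite -lee_fin -prob_outside_fin; apply: probability_le1.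
exact: (measurable_funPTI X (measurable_U c r)).
Qed.

Lemma outside_count_tail c r a : 0 <= a <= 1 -> (0 < M)%N ->
  measurable [set w | a * M%:R <= (outside_count c r w)%:R] /\
  (P [set w | (a * M%:R <= (outside_count c r w)%:R)%R] <=
   (expR (- (M%:R * Num.max (a - prob_outside X n r c) 0 ^+ 2 / 2)))%:E)%E.
Proof.
move=> a01 M0; case: copies => same indep.
have pE s : P (Xs s @^-1` U c r) = (prob_outside X n r c)%:E.
  by rewrite -prob_outside_fin; exact: (same s _ (measurable_U c r)).
have := @independent_count_tail _ Omega R P _ _ M (fun s w => Xs s w)
  (fun s => measurable_funP (Xs s)) indep _ _ (measurable_U c r) pE a a01 M0.
have -> // : [set w | a * M%:R <= #|[set s | Xs s w \in U c r]%SET|%:R] =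
  [set w | a * M%:R <= (outside_count c r w)%:R].
have e w : [set s | Xs s w \in U c r]%SET = [set s | `[< ~ eball c r (Xs s w)`_n >]]%SET.
  apply/setP => s; rewrite !finset.in_set; apply/idP/asboolP; first by rewrite inE.
  by move=> h; rewrite inE.
by apply/funext => w; rewrite /= /outside_count e.
Qed.

End outside_ball.

(** * Error on a fixed outcome outside the bad events *)

Section one_step_estimate.
Context {R : realType} {d D N M m k : nat}.
Local Notation E := 'rV[R]_d.
Variables (S : switching_problem R d D N).
Context {dO} {Omega : measurableType dO} (P : probability Omega R).
Variables (Xs : 'I_M -> {RV P >-> N.+1.-tuple E}) (Y : nat -> 'I_M -> 'I_m -> {RV P >-> E}).
Variables (nn : knn_rule R d M k) (trunc : nat -> R) (l1 l2 L : R) (n : nat).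
Hypotheses (d_gt0 : (0 < d)%N) (n_lt : (n < N)%N) (k_gt0 : (0 < k)%N) (m_gt0 : (0 < m)%N).
Hypotheses (l1_gt0 : 0 < l1) (l2_gt0 : 0 < l2) (L_gt0 : 0 < L).
Hypothesis p_bounds : forall x y,
  [/\ `|step_density S n x y| <= l1^-1 * expR (- (l1 * enorm (x - y))),
      differentiable (step_density S n ^~ y) x &
      enorm (gradient (step_density S n ^~ y) x) <= l2^-1 * expR (- (l2 * enorm (x - y)))].
Hypothesis truncE : trunc n = @growth_cst R d l1 L.
Variable w : Omega.
Local Notation V := (Vhat S nn trunc (Xs ^~ w) (fun n s h => Y n s h w)).
Local Notation W := (Vtilde S nn trunc (Xs ^~ w) (fun n s h => Y n s h w)).
Hypothesis V_growth : forall j x, `|V n.+1 j x| <= L * (enorm x + 1).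
Local Notation v := (clipped_value S nn trunc L n (data_tuple Xs w, sims_tuple Y w)).

(** On this outcome the growth bound holds, so the clipping is inactive. *)
Let vE j : V n.+1 j = v j.
Proof.
apply/funext => x; rewrite /clipped_value/=.
have -> : tnth (data_tuple Xs w) = Xs ^~ w by apply/funext => s; rewrite tnth_mktuple.
have -> : Vhat S nn trunc (Xs ^~ w) (sims_of (N := N) (sims_tuple Y w)) n.+1 j x = V n.+1 j x.
  have e := @eq_value_to_go R d D N M m k S nn trunc (Xs ^~ w) (sims_of (N := N) (sims_tuple Y w))
    (fun n s h => Y n s h w) (N - n.+1) (leq_subr _ _).
  by rewrite /Vhat e// => n' /andP[_ n'N] s h; rewrite sims_of_tuple.
by rewrite clip_id.
Qed.

Let mv j : measurable_fun setT (v j).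
Proof. exact: measurable_clipped_value_slice. Qed.

Let vL j y : `|v j y| <= L * (enorm y + 1).
Proof. exact: clipped_value_growth. Qed.

Let C0_ge0 : 0 <= @growth_cst R d l1 L.
Proof. exact/ltW/growth_cst_gt0. Qed.

Let g_growth j x : `|continuation S n (v j) x| <= @growth_cst R d l1 L * (enorm x + 1).
Proof. exact: (continuation_growth d_gt0 l1_gt0 L_gt0 (step_transition S n_lt) p_bounds). Qed.

Lemma step_error_growth i x : `|V n i x - W n i x| <= 3 * @growth_cst R d l1 L * (enorm x + 1).
Proof. exact: (Vhat_error_growth n_lt vE truncE C0_ge0 g_growth). Qed.

(** If at most M - k samples miss the ball around z, at least k lie in it, so the neighbours of x
    are within 2r <= 1. The bound on |x| + 2 then places these sources in the region of
    [deviation_event]. *)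
Lemma step_error_local i (x z : E) (r b lam K1 : R) :
  enorm (x - z) < r -> r + r <= 1 -> (k + outside_count (Xs := Xs) n z r w <= M)%N ->
  0 < lam -> enorm x + 2 <= K1 ->
  (forall j (I : {set 'I_M}) a, #|I| = k -> `|a| = lam ->
     ~ deviation_event S Xs Y nn trunc L n K1 j I a (lam * (k%:R * m%:R * b)) w) ->
  `|V n i x - W n i x| <= b + @lipschitz_cst R d l2 L * (enorm x + 1) * (r + r).
Proof.
move=> xz r1 few lam0 xK nodev.
have near s : s \in nn (points (Xs ^~ w) n) x -> enorm ((Xs s w)`_n - x) <= r + r.
  move=> sn; have := @knn_dist_le R d M k nn (points (Xs ^~ w) n) x z r xz _ s sn.
  rewrite tnth_mktuple; apply.
  have e : [set s | `[< eball z r (tnth (points (Xs ^~ w) n) s) >]]%SET =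
      (~: [set s | `[< ~ eball z r (Xs s w)`_n >]])%SET.
    apply/setP => s'; rewrite finset.in_setC 2!finset.in_set tnth_mktuple.
    by rewrite asbool_neg negbK.
  rewrite e; have := cardsC [set s | `[< ~ eball z r (Xs s w)`_n >]]%SET.
  by rewrite card_ord; move: few; rewrite /outside_count; lia.
apply: (Vhat_error_split n_lt vE truncE C0_ge0 g_growth) => //.
- move=> j; set I := nn _ _ in near *.
  have km : 0 < k%:R * m%:R :> R by rewrite mulr_gt0// ltr0n.
  rewrite normrM ger0_norm ?invr_ge0 ?(ltW km)// ler_pdivrMl//.
  set D0 := \sum_(s in I) _; rewrite leNgt; apply/negP => big.
  (* The sign makes a D0 = lam |D0|, so the two signs of [a] cover both tails. *)
  pose a := if 0 <= D0 then lam else - lam.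
  have aD : a * D0 = lam * `|D0|.
    by rewrite /a; case: (lerP 0 D0) => h; [rewrite ger0_norm|rewrite ltr0_norm// mulrN mulNr].
  apply: (nodev j I a); first exact: knn_card.
    by rewrite /a; case: ifP => _; rewrite ?normrN gtr0_norm.
  split => [s sI|]; last by rewrite aD ler_pM2l// ltW.
  have := le_enormB x (Xs s w)`_n; have := near s sI; rewrite enormB; lra.
- move=> j s sI.
  have close := le_trans (near s sI) r1.
  have := continuation_lipschitz d_gt0 l1_gt0 l2_gt0 L_gt0 (step_transition S n_lt) p_bounds
    (mv j) (vL j) close.
  move=> /le_trans; apply; apply: ler_wpM2l; last exact: near.
  by rewrite mulr_ge0 ?addr_ge0 ?enorm_ge0//; exact/ltW/lipschitz_cst_gt0.
Qed.

End one_step_estimate.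


(** * Choice of the constants and union of the bad events *)

Theorem theorem5p6 (R : realType) (d : nat) (L lambda1 lambda2 : R)
    (Q : set 'rV[R]_d) :
  (0 < d)%N -> 0 < L -> 0 < lambda1 -> 0 < lambda2 ->
  bounded_set Q -> (0 < volume Q)%E ->
  exists C0 C1 C2 sigma : R,
    [/\ 0 < C0, 0 < C1, 0 < C2 & 0 < sigma] /\
    forall (D M N m k : nat),
    (0 < D)%N -> (0 < M)%N -> (0 < N)%N -> (0 < m)%N -> (0 < k <= M)%N ->
    forall (S : switching_problem R d D N) (mu0 : probability 'rV[R]_d R)
      (disp0 : measure_display) (Omega0 : measurableType disp0)
      (P0 : probability Omega0 R) (X : {RV P0 >-> N.+1.-tuple 'rV[R]_d})
      (disp : measure_display) (Omega : measurableType disp)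
      (P : probability Omega R) (Xs : 'I_M -> {RV P >-> N.+1.-tuple 'rV[R]_d})
      (Y : nat -> 'I_M -> 'I_m -> {RV P >-> 'rV[R]_d})
      (nn : knn_rule R d M k) (trunc : nat -> R),
    sub_gaussian mu0 ->
    markov_chain mu0 (step_density S) X ->
    independent_copies X Xs ->
    conditional_simulations (step_density S) Xs Y ->
    let V w := Vhat S nn trunc (Xs ^~ w) (fun n s h => Y n s h w) in
    let W w := Vtilde S nn trunc (Xs ^~ w) (fun n s h => Y n s h w) in
    forall n : nat, (n < N)%N -> trunc n = C0 ->
    (forall n', (n' < N)%N -> forall x y : 'rV[R]_d,
      [/\ `|step_density S n' x y| <= lambda1^-1 * expR (- (lambda1 * enorm (x - y))),
          differentiable (step_density S n' ^~ y) x &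
          enorm (gradient (step_density S n' ^~ y) x) <=
            lambda2^-1 * expR (- (lambda2 * enorm (x - y)))]) ->
    {ae P, forall w, forall (i : 'I_D) (x : 'rV[R]_d),
      `|V w n.+1 i x| <= L * (enorm x + 1)} ->
    forall delta : R, 0 < delta -> forall i : 'I_D,
    (mu_ext P [set w |
       (delta%:E <= ereal_sup [set (`|V w n i x - W w n i x|)%:E | x in Q])%E]
     <= (2 * D%:R * 'C(M, k)%:R *
           Num.max (expR (- (k%:R * m%:R * delta ^+ 2 / (18 * sigma ^+ 2))))
                   (expR (- (k%:R * m%:R * delta / (6 * sigma)))) +
         D%:R * covering_bound M k Q (prob_outside X n) C1 C2 delta)%:E)%E.
Proof.
move=> d_gt0 L_gt0 l1_gt0 l2_gt0 Qb Qvol.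
have [R0 R0_gt0 QR] := bounded_set_coord Qb.
have [Cn Cn_gt0 net] := bounded_set_net d_gt0 Qb.
have vol_gt0 : 0 < fine (volume Q) by rewrite fine_gt0// Qvol volume_lty.
pose C0 := @growth_cst R d lambda1 L.
have C0_gt0 : 0 < C0 by exact: growth_cst_gt0.
pose KQ := d%:R * R0 + 1.
have QK x : Q x -> enorm x + 1 <= KQ.
  move=> Qx; rewrite lerD2r; apply: le_trans (enorm_le_sum x) _.
  apply: (@le_trans _ _ (\sum_(i < d) R0)); first by apply: ler_sum => i _; exact: QR.
  by rewrite sumr_const card_ord mulr_natl.
have KQ_gt0 : 0 < KQ by rewrite addr_gt0// mulr_gt0// ltr0n.
(* The extra 1 accommodates neighbours, which lie within distance 1 of Q. *)
pose K1 := KQ + 1.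
pose Lam := @lipschitz_cst R d lambda2 L * KQ.
have Lam_gt0 : 0 < Lam by rewrite mulr_gt0// lipschitz_cst_gt0.
(* The first term bounds the error on Q; the second brings the bias at distance delta/(2 C2) down to
   delta/4. *)
pose C2 := 3 * C0 * KQ + 2 * Lam + 1.
have CK_gt0 : 0 < 3 * C0 * KQ by do 2?apply: mulr_gt0.
have C2_gt0 : 0 < C2 by rewrite /C2; lra.
have C2_growth : 3 * C0 * KQ <= C2 by rewrite /C2; lra.
have C2_Lam : 2 * Lam <= C2 by rewrite /C2; lra.
pose scale := @step_scale R d lambda1 L K1.
have K1_0 : enorm (0 : 'rV[R]_d) + 1 <= K1 by rewrite enorm0 /K1; lra.
have scale_gt0 : 0 < scale by exact: (step_scale_gt0 d_gt0 l1_gt0 L_gt0 K1_0).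
pose variance := @step_variance R d lambda1 L K1.
have variance_ge0 : 0 <= variance.
  rewrite /variance /step_variance; apply: mulr_ge0; last exact/ltW/exp_mass_gt0/divr_gt0.
  rewrite -/scale; apply: mulr_ge0; last by rewrite invr_ge0 ltW.
  by rewrite mulr_ge0 ?expR_ge0// divr_ge0// sqr_ge0.
(* The added term keeps [lam] below scale/2 for every delta <= C2. *)
pose W0 := variance + C2 / scale.
have W0_gt0 : 0 < W0 by rewrite ltr_wpDl// divr_gt0.
pose sigma := Num.sqrt (8 / 9 * W0).
have sigma2 : sigma ^+ 2 = 8 / 9 * W0 by rewrite sqr_sqrtr// mulr_ge0// ltW.
(* Chosen so that C1 |Q| / delta^d is the bound Cn / r^d on the size of the net with r = delta/(4
   C2). *)
pose C1 := Cn * (4 * C2) ^+ d / fine (volume Q).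
exists C0, C1, C2, sigma; split.
  split => //; first by rewrite divr_gt0// mulr_gt0// exprn_gt0// mulr_gt0.
  by rewrite sqrtr_gt0 mulr_gt0.
move=> D M N m k D_gt0 M_gt0 N_gt0 m_gt0 /andP[k_gt0 kM] S mu0 disp0 Omega0 P0 X
  disp Omega P Xs Y nn trunc _ _ copies sims V W n n_lt truncE p_bounds V_ae delta delta_gt0 i.
have pb := p_bounds n n_lt.
have tail_ge0 r : 0 <= expR (- (M%:R * Num.max ((M%:R - k%:R) / M%:R -
    sup [set prob_outside X n r x | x in Q]) 0 ^+ 2 / 2)) by exact: expR_ge0.
have C1_ge0 : 0 <= C1.
  rewrite divr_ge0 ?(ltW vol_gt0)// mulr_ge0 ?(ltW Cn_gt0)// exprn_ge0// mulr_ge0//.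
  exact: ltW.
have cover_ge0 : 0 <= covering_bound M k Q (prob_outside X n) C1 C2 delta.
  rewrite /covering_bound; case: ifP => _; apply: mulr_ge0 => //; apply: mulr_ge0 => //;
    apply: divr_ge0; rewrite ?(ltW vol_gt0) ?exprn_ge0 ?powR_ge0// ltW//.
set e0 := expR (- (k%:R * m%:R * delta ^+ 2 / (18 * sigma ^+ 2))).
set dev := 2 * D%:R * 'C(M, k)%:R * Num.max e0 _.
have dev_ge0 : 0 <= dev by rewrite !mulr_ge0// le_max expR_ge0.
have rhs_ge0 : 0 <= dev + D%:R * covering_bound M k Q (prob_outside X n) C1 C2 delta.
  by rewrite addr_ge0// mulr_ge0.
set event := [set w | _].
pose bad := ~` [set w | forall (j : 'I_D) x, `|V w n.+1 j x| <= L * (enorm x + 1)].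
have bad0 : P.-negligible bad by exact: V_ae.
have event_lt w b : ~ bad w -> event w ->
    (forall x, Q x -> `|V w n i x - W w n i x| <= b) -> delta <= b.
  move=> _ ew h; rewrite -lee_fin; apply: le_trans ew _.
  by apply: ge_ereal_sup => _ [x Qx <-]; rewrite lee_fin; exact: h.
(* For delta > C2 the event lies in the null set, so the empty family covers it. *)
have [dC|dC] := leP (delta / C2) 1; last first.
  apply: (@le_trans _ _ (\sum_(q : 'I_0) P set0)%E); last by rewrite big_ord0 lee_fin.
  apply: (mu_ext_finite_cover_le bad0) => // w ew nbad; exfalso.
  have V_growth : forall j x, `|V w n.+1 j x| <= L * (enorm x + 1) by exact: contrapT.
  suff : delta <= C2 by rewrite leNgt; move: dC; rewrite ltr_pdivlMr// mul1r => ->.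
  apply: le_trans C2_growth; apply: (event_lt w) => // x Qx.
  apply: le_trans (step_error_growth d_gt0 n_lt l1_gt0 L_gt0 pb truncE V_growth i x) _.
  by apply: ler_wpM2l; [rewrite mulr_ge0// ltW|exact: QK].
have dC2 : delta <= C2 by move: dC; rewrite ler_pdivrMr// mul1r.
pose r := delta / (4 * C2).
have r_gt0 : 0 < r by rewrite divr_gt0// mulr_gt0.
have rE : r + r = delta / C2 / 2 by rewrite /r; field; rewrite gt_eqF.
have r1 : r + r <= 1 by rewrite rE ler_pdivrMr// mul1r (le_trans dC)// ler1n.
have r01 : 0 < r <= 1 by rewrite r_gt0 (le_trans _ r1)// lerDl ltW.
have [K [c [Qc cover card_net]]] := net r r01.
(* Minimises W0 lam^2 - lam delta / 2; the minimum is -delta^2 / (16 W0). *)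
pose lam := delta / (4 * W0).
have lam_gt0 : 0 < lam by rewrite divr_gt0// mulr_gt0.
have lam_scale : lam <= scale / 2.
  rewrite ler_pdivrMr ?mulr_gt0//.
  have -> : scale / 2 * (4 * W0) = 2 * (scale * variance) + 2 * C2.
    by rewrite /W0; field; rewrite gt_eqF.
  apply: (le_trans dC2); rewrite -[leLHS]add0r; apply: lerD.
    by apply: mulr_ge0 => //; apply: mulr_ge0 => //; exact: ltW.
  by rewrite ler_peMl ?ler1n// ltW.
pose a0 : R := (M%:R - k%:R) / M%:R.
have MR : 0 < M%:R :> R by rewrite ltr0n.
have a01 : 0 <= a0 <= 1.
  rewrite divr_ge0 ?subr_ge0 ?ler_nat//= ler_pdivrMr// mul1r lerBlDr lerDl.
  exact: ler0n.
pose t0 := lam * (k%:R * m%:R * (delta / 2)).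
pose sgn (b : bool) := if b then lam else - lam.
pose B (q : 'I_K + 'I_D * {set 'I_M} * bool) : set Omega := match q with
  | inl q => [set w | a0 * M%:R <= (outside_count (Xs := Xs) n (c q) r w)%:R]
  | inr (j, J, b) => if #|J| == k then deviation_event S Xs Y nn trunc L n K1 j J (sgn b) t0
                     else set0
  end.
have devP j (I : {set 'I_M}) b : #|I| = k ->
    measurable (deviation_event S Xs Y nn trunc L n K1 j I (sgn b) t0) /\
    (P (deviation_event S Xs Y nn trunc L n K1 j I (sgn b) t0) <= e0%:E)%E.
  move=> Ik; have asc : `|sgn b| <= scale / 2.
    by rewrite /sgn; case: b; rewrite ?normrN gtr0_norm.
  have [mdev] := deviation_event_bound sims nn trunc d_gt0 n_lt l1_gt0 l2_gt0 L_gt0 pb j I t0 asc.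
  move=> hdev; split => //; apply: le_trans hdev _; rewrite lee_fin ler_expR -/variance.
  have -> : sgn b ^+ 2 = lam ^+ 2 by rewrite /sgn; case: (b); rewrite ?sqrrN.
  rewrite Ik natrM sigma2.
  have -> : - (k%:R * m%:R * delta ^+ 2 / (18 * (8 / 9 * W0))) =
      W0 * lam ^+ 2 * (k%:R * m%:R) - t0.
    by rewrite /t0 /lam; field; rewrite gt_eqF.
  rewrite lerD2r; apply: ler_wpM2r; first by rewrite mulr_ge0.
  apply: ler_wpM2r; first exact: sqr_ge0.
  by rewrite /W0 lerDl divr_ge0// ltW.
have countP q := outside_count_tail copies (ltnW n_lt) (c q) r a01 M_gt0.
have mB q : measurable (B q).
  case: q => [q|[[j I] b]] /=; first by case: (countP q).
  by case: eqP => // /(devP j I b)[].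
have event_sub w : event w -> ~ bad w -> exists q, B q w.
  move=> ew nbad; apply: contrapT => nB.
  have V_growth : forall j x, `|V w n.+1 j x| <= L * (enorm x + 1) by exact: contrapT.
  (* Off the bad events the error would be at most 3 delta / 4, whereas its supremum is at least
     delta. *)
  have : delta <= delta / 2 + delta / 4.
    apply: (event_lt w) => // x Qx; have [q xq] := cover x Qx.
    have few : (k + outside_count (Xs := Xs) n (c q) r w <= M)%N.
      rewrite leqNgt; apply/negP => many; apply: nB; exists (inl q) => /=.
      by rewrite /a0 divfK ?gt_eqF// lerBlDr -natrD ler_nat addnC ltnW.
    have xK : enorm x + 2 <= K1 by rewrite /K1 (_ : 2 = 1 + 1 :> R)// addrA lerD2r; exact: QK.
    have := step_error_local (b := delta / 2) (lam := lam) d_gt0 n_lt k_gt0 m_gt0 l1_gt0 l2_gt0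
      L_gt0 pb truncE V_growth i xq r1 few lam_gt0 xK.
    move=> /(_ _)/le_trans; apply.
      move=> j I a Ik alam dv; apply: nB.
      exists (inr (j, I, a == lam)); rewrite /= Ik eqxx /sgn; case: eqP => [<-//|ne].
      have <- // : a = - lam; case: (ltrP a 0) alam => h.
        by rewrite ltr0_norm// => <-; rewrite opprK.
      by rewrite ger0_norm// => /ne.
    rewrite lerD2l rE.
    apply: (@le_trans _ _ (Lam * (delta / C2 / 2))).
      apply: ler_wpM2r; first by rewrite -rE addr_ge0// ltW.
      by apply: ler_wpM2l; [exact/ltW/lipschitz_cst_gt0|exact: QK].
    have -> : Lam * (delta / C2 / 2) = delta / 4 * (2 * Lam / C2) by field; rewrite gt_eqF.
    by rewrite ler_piMr ?divr_ge0 ?(ltW delta_gt0)// ler_pdivrMr// mul1r.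
  by rewrite leNgt => /negP; apply; move: delta_gt0; clear; lra.
apply: le_trans (mu_ext_finite_cover_le bad0 mB event_sub) _.
rewrite big_sumType/= addeC EFinD; apply: leeD.
- apply: (@le_trans _ _ (\sum_(q : 'I_D * {set 'I_M} * bool)
      (if #|q.1.2| == k then e0 else 0)%:E)%E).
    apply: lee_sum => -[[j I] b] _ /=; case: eqP => [Ik|_]; last by rewrite measure0.
    by case: (devP j I b Ik).
  rewrite sumEFin lee_fin.
  have -> : \sum_(q : 'I_D * {set 'I_M} * bool) (if #|q.1.2| == k then e0 else 0) =
      2 * D%:R * 'C(M, k)%:R * e0.
    transitivity (\sum_(j < D) \sum_(I : {set 'I_M}) \sum_(b : bool) (if #|I| == k then e0 else 0)).
      by rewrite pair_bigA pair_bigA.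
    rewrite sumr_const card_ord; under eq_bigr do rewrite sumr_const card_bool.
    rewrite sumrMnl -big_mkcond sumr_const.
    have -> : #|[pred I : {set 'I_M} | #|I| == k]| = 'C(M, k).
      by rewrite -[in RHS](card_ord M) -card_draws; apply: eq_card => I; rewrite finset.in_set.
    by rewrite -[LHS]mulr_natl -[X in _ * X]mulr_natl -[X in _ * (_ * X)]mulr_natl; ring.
  by apply: ler_wpM2l; rewrite ?mulr_ge0// le_max lexx.
- apply: (@le_trans _ _ (\sum_(q < K) (expR (- (M%:R * Num.max (a0 -
      sup [set prob_outside X n r x | x in Q]) 0 ^+ 2 / 2)))%:E)%E).
    apply: lee_sum => q _; have [_ /le_trans] := countP q; apply.
    rewrite lee_fin ler_expR lerN2 -!(mulrA M%:R); apply: ler_wpM2l; first exact: ltW.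
    apply: ler_wpM2r; first by rewrite invr_ge0.
    have max0 (z : R) : 0 <= Num.max z 0 by rewrite le_max lexx orbT.
    rewrite ler_sqr ?nnegrE// ge_max max0 andbT le_max; apply/orP; left.
    (* This is where the centres of the net must lie in Q; the bound 1 on probabilities makes the
       supremum meaningful. *)
    rewrite lerD2l lerN2; apply: ub_le_sup; last by exists (c q).
    exists 1 => _ [x _ <-]; by apply: prob_outside_le1; exact: ltnW.
  rewrite sumEFin lee_fin sumr_const card_ord.
  apply: (@le_trans _ _ (covering_bound M k Q (prob_outside X n) C1 C2 delta)); last first.
    by rewrite ler_peMl// ler1n.
  rewrite /covering_bound dC /= -[leLHS]mulr_natl; apply: ler_wpM2r => //.
  apply: le_trans card_net _; rewrite /r /C1 expr_div_n invf_div.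
  rewrite le_eqVlt; apply/orP; left; apply/eqP; field.
  by rewrite !gt_eqF// exprn_gt0.
Qed.
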